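(* The following is in the $\Omega$-cluster: a functional that for $f\in BV$ with the Lusin $N$-property outputs $x\in[0,1]$ where $f$ is discontinuous if $f\notin AC$.
   Context: $BV$ is the class of $f:[0,1]\to\mathbb R$ for which there is $k_0\in\mathbb N$ with $\sum_i|f(x_i)-f(x_{i+1})|\le k_0$ for every partition of $[0,1]$. $f$ has the Lusin $N$-property if for every measure zero set $N\subset[0,1]$ the image $f(N)$ has measure zero. $AC$ is the class of absolutely continuous $f:[0,1]\to\mathbb R$: for every $k\in\mathbb N$ there is $N\in\mathbb N$ such that for every finite sequence of pairwise disjoint sub-intervals $(x_i,y_i)$ of $[0,1]$ with $\sum_i(y_i-x_i)<2^{-N}$, we have $\sum_i|f(y_i)-f(x_i)|<2^{-k}$. (The functional always outputs some $x\in[0,1]$ on such $f$; the discontinuity requirement applies only when $f\notin AC$.) $\Omega$-cluster: $\Omega(X)$ is defined for $X\subset[0,1]$ with $|X|\le 1$ and outputs a finite sequence that includes all elements of $X$. The $\Omega$-cluster is the class of partial functionals $\Phi$ computationally equivalent to $\Omega$ modulo $\exists^2$, i.e. $\Phi$ is computable in $\Omega$ and $\exists^2$, and $\Omega$ is computable in $\Phi$ and $\exists^2$. A description of a functional that does not determine it uniquely defines a class of functionals; such a class is in the $\Omega$-cluster if $\Omega$ is computable, modulo $\exists^2$, in all elements of the class and at least one element of the class is in the $\Omega$-cluster. Here $\exists^2:\mathbb N^{\mathbb N}\to\{0,1\}$ satisfies $\exists^2(f)=0$ iff $f(n)=0$ for some $n$. Representations: reals are fast-converging Cauchy sequences of rationals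 ($|q_n-q_{n+i}|<2^{-n}$); functions on the reals are functionals respecting equality of reals; sets are given by characteristic functions. Computability: Kleene's S1–S9, where partial functionals of type rank $\le 3$ (taking only total arguments, possibly undefined) are allowed as oracles. That is, $\{e\}(\vec\phi)\simeq a$ is the least relation closed under Kleene's schemes: successor, constants, projection to a number argument, composition, primitive recursion, permutation of arguments, application of an argument, and S9: $\{e\}(m,\vec\phi,\vec\psi)\simeq\{m\}(\vec\phi)$. An application of $\phi_i$ to functionals $\lambda\vec\xi.\{d\}(\vec\xi,\vec\phi)$ has a value iff these functionals are total and $\phi_i$ is defined on them. A partial functional $\psi$ is computable in $\vec\phi$ if for some $e$, $\{e\}(\vec\xi,\vec\phi)\simeq\psi(\vec\xi)$ for all total $\vec\xi$ for which $\psi(\vec\xi)$ is defined. Functionals with outputs coded in $\mathbb N^{\mathbb N}$ are viewed as $\mathbb N$-valued with an extra number argument. *)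

(* Defs.v *)
From HB Require Import structures.
From mathcomp Require Import all_boot all_order all_algebra.
From mathcomp Require Import all_classical all_reals all_analysis.

Set Implicit Arguments.
Unset Strict Implicit.
Unset Printing Implicit Defensive.

Import Order.TTheory GRing.Theory Num.Theory.
Import numFieldNormedType.Exports.
Local Open Scope classical_set_scope.
Local Open Scope ring_scope.

(* Finite types. Every type is t1 -> ... -> tk -> Nat; an output in N^N is
   thus, after uncurrying, a number output with an extra number argument. *)
Inductive fintp := Nat | Arr of fintp & fintp.

Declare Scope fintp_scope.
Delimit Scope fintp_scope with fintp.
Bind Scope fintp_scope with fintp.
Notation "s ~> t" := (Arr s t) (at level 55, right associativity) : fintp_scope.

Fixpoint functional (t : fintp) : Type :=
  if t is Arr s u then functional s -> functional u else nat.

(* Partial functionals take total arguments only; None is "undefined". *)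
Fixpoint pfunctional (t : fintp) : Type :=
  if t is Arr s u then functional s -> pfunctional u else option nat.

Fixpoint to_partial (t : fintp) : functional t -> pfunctional t :=
  match t with
  | Nat => fun n => Some n
  | Arr s u => fun f x => to_partial (f x)
  end.

(* The argument lists (x1, ..., xk) of a functional of type t. *)
Fixpoint arguments (t : fintp) : Type :=
  if t is Arr s u then (functional s * arguments u)%type else unit.

Fixpoint fapply (t : fintp) : functional t -> arguments t -> nat :=
  match t with
  | Nat => fun n _ => n
  | Arr s u => fun f xs => fapply (f xs.1) xs.2
  end.

Fixpoint papply (t : fintp) : pfunctional t -> arguments t -> option nat :=
  match t with
  | Nat => fun n _ => n
  | Arr s u => fun f xs => papply (f xs.1) xs.2
  end.

(* The entries of the argument list phi of {e}(phi): numbers and (possibly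
   partial) functionals of mixed types. *)
Definition entry : Type := {t : fintp & pfunctional t}.

Definition pent (t : fintp) (f : pfunctional t) : entry := existT pfunctional t f.

Definition tent (t : fintp) (f : functional t) : entry := pent (to_partial f).

Definition nent (n : nat) : entry := @tent Nat n.

Fixpoint entries (t : fintp) : arguments t -> seq entry :=
  match t with
  | Nat => fun _ => [::]
  | Arr s u => fun xs => tent xs.1 :: entries xs.2
  end.

(* Kleene's S1-S9. [keval e phi a] is {e}(phi) ~ a; an index e is a number, the
   code of a sequence of numbers whose head names the scheme. The number k of
   arguments kept by S9 is part of the index; S8 includes S7.
   [kevals ds phi xs] says that, for ds = [:: d1; ...; dk], each functional
   fun xi => {dj}(xi, phi) is total and equal to the j-th component of xs. *)
Inductive keval : nat -> seq entry -> nat -> Prop :=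
| eval_S1 m phi :
    keval (CodeSeq.code [:: 1%N]) (nent m :: phi) m.+1
| eval_S2 q phi :
    keval (CodeSeq.code [:: 2%N; q]) phi q
| eval_S3 m phi :
    keval (CodeSeq.code [:: 3%N]) (nent m :: phi) m
| eval_S4 d d' phi b a :
    keval d phi b -> keval d' (nent b :: phi) a ->
    keval (CodeSeq.code [:: 4%N; d; d']) phi a
| eval_S5_0 d d' phi a :
    keval d phi a ->
    keval (CodeSeq.code [:: 5%N; d; d']) (nent 0 :: phi) a
| eval_S5_S d d' m phi b a :
    keval (CodeSeq.code [:: 5%N; d; d']) (nent m :: phi) b ->
    keval d' [:: nent b, nent m & phi] a ->
    keval (CodeSeq.code [:: 5%N; d; d']) (nent m.+1 :: phi) a
| eval_S6 d s phi a :
    perm_eq s (iota 0 (size phi)) ->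
    keval d [seq nth (nent 0) phi i | i <- s] a ->
    keval (CodeSeq.code [:: 6%N, d & s]) phi a
| eval_S8 i ds phi xs a :
    (i < size phi)%N ->
    kevals ds phi xs ->
    papply (projT2 (nth (nent 0) phi i)) xs = Some a ->
    keval (CodeSeq.code [:: 8%N, i & ds]) phi a
| eval_S9 k m phi psi a :
    size phi = k ->
    keval m phi a ->
    keval (CodeSeq.code [:: 9%N; k]) (nent m :: phi ++ psi) a
with kevals : seq nat -> seq entry -> forall t, arguments t -> Prop :=
| evals_nil phi : kevals [::] phi (t := Nat) tt
| evals_cons d ds phi s u (x : functional s) (xs : arguments u) :
    (forall xi : arguments s, keval d (entries xi ++ phi) (fapply x xi)) ->
    kevals ds phi xs ->
    kevals (d :: ds) phi (t := Arr s u) (x, xs).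

Definition computable_in (t : fintp) (psi : pfunctional t) (phi : seq entry) :=
  exists e, forall (xi : arguments t) a,
    papply psi xi = Some a -> keval e (entries xi ++ phi) a.

Notation Baire := (Nat ~> Nat)%fintp.

Definition existsE2 : functional (Baire ~> Nat) :=
  fun f => if `[< exists n, f n = 0%N >] then 0%N else 1%N.

Section Representations.
Context {R : realType}.

(* A surjection of N onto Q: (a, b, c) is sent to (a - b) / (c + 1). *)
Definition rat_of_code (n : nat) : rat :=
  if CodeSeq.decode n is [:: a; b; c] then (a%:R - b%:R) / c.+1%:R else 0.

Definition codes_real (al : functional Baire) (x : R) :=
  (forall n i,
     `|rat_of_code (al n) - rat_of_code (al (n + i)%N)| < 2%:R ^- n) /\
  (fun n => ratr (rat_of_code (al n)) : R) @ \oo --> x.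

(* be 0 is the length, and the i-th real is coded by n |-> be (<i, n> + 1). *)
Definition codes_seq (be : functional Baire) (s : seq R) :=
  be 0%N = size s /\
  forall i, (i < size s)%N ->
    codes_real (fun n => be (CodeSeq.code [:: i; n]).+1) (nth 0 s i).

(* F codes f : [0,1] -> R; values of f off [0,1] and values of F off the codes
   of elements of [0,1] are irrelevant. *)
Definition codes_fun (F : functional (Baire ~> Baire)) (f : R -> R) :=
  forall x al, 0 <= x <= 1 -> codes_real al x -> codes_real (F al) (f x).

Definition codes_set (F : functional (Baire ~> Nat)) (X : set R) :=
  X `<=` `[0, 1]%classic /\
  forall x al, 0 <= x <= 1 -> codes_real al x -> F al = (x \in X).

Definition lusinN (f : R -> R) :=
  forall N : set R, N `<=` `[0, 1]%classic ->
    (@lebesgue_measure R).-negligible N ->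
    (@lebesgue_measure R).-negligible (f @` N).

Definition AC (f : R -> R) :=
  forall k : nat, exists N : nat, forall (n : nat) (x y : 'I_n -> R),
    (forall i, [/\ 0 <= x i, x i < y i & y i <= 1]) ->
    trivIset setT (fun i => `]x i, y i[%classic) ->
    \sum_(i < n) (y i - x i) < 2%:R ^- N ->
    \sum_(i < n) `|f (y i) - f (x i)| < 2%:R ^- k.

Definition discontinuous_at (f : R -> R) (x : R) :=
  ~ (f @ within `[0, 1]%classic (nbhs x) --> f x).

End Representations.

(* Omega is only specified by this property: it has exactly the stated domain,
   and the finite sequence returned for X is not determined. *)
Definition is_Omega (R : realType)
    (Om : pfunctional ((Baire ~> Nat) ~> Baire)) :=
  forall F,
    (forall X : set R, codes_set F X -> is_subset1 X ->
       exists be s, [/\ forall n, Om F n = Some (be n),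
                        codes_seq be s & forall x, X x -> x \in s]) /\
    (~ (exists2 X : set R, codes_set F X & is_subset1 X) ->
       forall n, Om F n = None).

(* Omega being itself given by a specification, "Omega is computable in Phi"
   means that some functional meeting it is, and "Phi is computable in Omega"
   that Phi is computable in every functional meeting it. *)
Definition Omega_computable_in (R : realType) (t : fintp)
    (Phi : pfunctional t) :=
  exists2 Om, is_Omega R Om &
    computable_in Om [:: pent Phi; tent existsE2].

Definition computable_in_Omega (R : realType) (t : fintp)
    (Phi : pfunctional t) :=
  forall Om, is_Omega R Om ->
    computable_in Phi [:: pent Om; tent existsE2].

Definition Omega_cluster (R : realType) (t : fintp) (Phi : pfunctional t) :=
  computable_in_Omega R Phi /\ Omega_computable_in R Phi.

Definition class_in_Omega_cluster (R : realType) (t : fintp)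
    (C : set (pfunctional t)) :=
  (forall Phi, C Phi -> Omega_computable_in R Phi) /\
  (exists2 Phi, C Phi & Omega_cluster R Phi).

Definition discontinuity_functional (R : realType) :
    set (pfunctional ((Baire ~> Baire) ~> Baire)) :=
  [set Phi | forall F (f : R -> R),
     codes_fun F f -> bounded_variation 0 1 f -> lusinN f ->
     exists be x, [/\ forall n, Phi F n = Some (be n),
                      codes_real be x, 0 <= x <= 1 &
                      ~ AC f -> discontinuous_at f x]].

(* Main.v *)
From HB Require Import structures.
Require Import Defs.
From mathcomp Require Import all_boot all_order all_algebra.
From mathcomp Require Import all_classical all_reals all_analysis.
From mathcomp Require Import measurable_realfun ring lra.

(** The indicator of a set [X] with at most one element has bounded variation and
    the Lusin property, is not absolutely continuous unless [X] is empty, and is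
    discontinuous only on [X]; this gives Omega from a discontinuity functional.
    Conversely, continuous functions of bounded variation with the Lusin property
    are absolutely continuous (Banach-Zarecki), so it suffices to find a point of
    the set [X] of those x at which the values of f at nearby rationals jump away
    from f x, which existsE2 decides.  Order [X] by size of the jump, up to powers
    of 2, and then by position.  As f has bounded variation this is a well-order,
    so the recursion theorem lets Omega decide whether x in [X] has a predecessor:
    apply Omega to the set of those predecessors of x that have themselves no
    predecessor, which has at most one element.  Then a last application of Omega
    yields the least element of [X]. *)

Set Implicit Arguments.
Unset Strict Implicit.
Unset Printing Implicit Defensive.

Import Order.TTheory GRing.Theory Num.Theory.
Import numFieldNormedType.Exports.

(** An oracle only accepts total arguments, and [existsE2] only quantifies over numbers. So the set
    given to Omega must be decided on every sequence, including those that code no real, and the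
    recursive calls inside it must be guarded: they are made at predecessors only, where
    well-foundedness makes them terminate. Restricting the jumps to rational points makes them
    arithmetical. Nothing is lost, because a function without such a jump at any point is
    continuous.

    The order must be total as well as well-founded: totality makes points without predecessor
    unique, and for this the position breaks ties between jumps of the same level. If a point has a
    predecessor, then the minimal point is one, so it suffices to test the finitely many reals
    listed by Omega. Since these lists are not determined by the specification of Omega, the answer
    is not read off from them directly. It is rebuilt from comparisons of the least point with
    dyadic rationals, whose truth does not depend on the list. *)

Local Notation baire := (Nat ~> Nat)%fintp.
Local Arguments CodeSeq.code : simpl never.

(** * Kleene computations uniform in a parameter *)

(* An argument list depending on a parameter in A, whose shape does not depend on
   it. Programs only see the arguments, so the parameter may carry more data. *)
Record env (A : Type) := Env {
  ent :> A -> seq entry;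
  esize : nat;
  E2pos : nat;
  esizeP : forall a, size (ent a) = esize;
  E2pos_lt : (E2pos < esize)%N;
  E2posP : forall a, nth (nent 0) (ent a) E2pos = tent existsE2 }.

Definition push A (G : env A) s : env (A * functional s).
Proof.
exists (fun p => tent p.2 :: G p.1) (esize G).+1 (E2pos G).+1.
- by move=> a; rewrite /= esizeP.
- by rewrite ltnS E2pos_lt.
- by move=> a; exact: E2posP.
Defined.

(** One index must serve all parameters in [D]. Outside [D] it may diverge, which leaves room for
    partial oracles and guarded recursive calls. *)
Definition Comp A (G : env A) (D : A -> Prop) (g : A -> nat) :=
  exists e, forall a, D a -> keval e (G a) (g a).

Section Closure.
Context {A : Type}.
Implicit Types (G : env A) (D : A -> Prop) (g h n : A -> nat).

Lemma comp_ext G D g h : (forall a, D a -> g a = h a) ->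
  Comp G D g -> Comp G D h.
Proof. by move=> gh [e He]; exists e => a Da; rewrite -gh//; exact: He. Qed.

Lemma comp_dom D' G D g : (forall a, D a -> D' a) -> Comp G D' g -> Comp G D g.
Proof. by move=> DD' [e He]; exists e => a /DD'; exact: He. Qed.

Lemma comp_const G D c : Comp G D (fun=> c).
Proof. by eexists => a _; exact: eval_S2. Qed.

(** The body may assume that the new argument is the computed value; this matters when the value is
    an index to be run. *)
Lemma comp_let G D g (h : A * nat -> nat) :
  Comp G D g -> Comp (push G Nat) (fun p => D p.1 /\ p.2 = g p.1) h ->
  Comp G D (fun a => h (a, g a)).
Proof.
move=> [d Hd] [d' Hd']; eexists => a Da.
by apply: eval_S4; [exact: Hd|exact: (Hd' (a, g a))].
Qed.

Lemma comp_succ G D g : Comp G D g -> Comp G D (fun a => (g a).+1).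
Proof.
move=> [d Hd]; eexists => a Da.
by apply: eval_S4; [exact: Hd|exact: eval_S1].
Qed.

(* S6 brings the arguments listed in s to the front and S9 forgets the others. *)
Lemma comp_call G D (s : seq nat) m g : Comp G D m ->
  uniq s -> all (fun i => i < esize G)%N s ->
  (forall a, D a -> keval (m a) [seq nth (nent 0) (G a) i | i <- s] (g a)) ->
  Comp G D g.
Proof.
move=> [d Hd] us lts H.
pose t := 0%N :: [seq i.+1 | i <- s] ++
  [seq i.+1 | i <- iota 0 (esize G) & i \notin s].
eexists => a Da.
apply: eval_S4; first exact: Hd.
apply: (@eval_S6 _ t).
  rewrite /= esizeP perm_cons -map_cat -[1%N]/(1 + 0)%N iotaDl.
  have -> : [seq (1 + i)%N | i <- iota 0 (esize G)] = map succn (iota 0 (esize G)).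
    exact: eq_map.
  apply: perm_map; apply: uniq_perm => [||i].
  - rewrite cat_uniq us filter_uniq ?iota_uniq// andbT.
    by apply/hasPn => i; rewrite mem_filter => /andP[].
  - exact: iota_uniq.
  - rewrite mem_cat mem_filter mem_iota/= add0n.
    by case: (boolP (i \in s)) => //= /(allP lts) ->.
rewrite /t /= map_cat -map_comp.
have -> : map (nth (nent 0) (nent (m a) :: G a) \o succn) s =
  map (nth (nent 0) (G a)) s by exact: eq_map.
apply: (@eval_S9 (size s)); first by rewrite size_map.
exact: H.
Qed.

End Closure.

Section Weakening.
Context {A : Type}.
Implicit Types (G : env A) (D : A -> Prop) (g h n : A -> nat).

Lemma comp_rename B (H : env B) (DB : B -> Prop) (f : A -> B) (s : seq nat) G D
    (g : B -> nat) :
  uniq s -> all (fun i => i < esize G)%N s ->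
  (forall a, D a -> H (f a) = [seq nth (nent 0) (G a) i | i <- s]) ->
  (forall a, D a -> DB (f a)) -> Comp H DB g -> Comp G D (fun a => g (f a)).
Proof.
move=> us sG HG DDB [e He]; apply: comp_call (comp_const G D e) us sG _ => a Da.
by rewrite -HG//; exact/He/DDB.
Qed.

Lemma comp_wk G D g s : Comp G D g ->
  Comp (push G s) (fun p => D p.1) (fun p => g p.1).
Proof.
move=> [e He].
apply: (@comp_call _ (push G s) _ (iota 1 (esize G)) (fun=> e)).
- exact: comp_const.
- exact: iota_uniq.
- by apply/allP => i; rewrite mem_iota add1n => /andP[].
- move=> [a x] /= Da; rewrite -[1%N]/(1 + 0)%N iotaDl -map_comp.
  have -> : map (nth (nent 0) (tent x :: G a) \o addn 1) (iota 0 (esize G)) =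
     map (nth (nent 0) (G a)) (iota 0 (esize G)) by exact: eq_map.
  by rewrite -(esizeP G a) -/(mkseq _ _) mkseq_nth; exact: He.
Qed.
End Weakening.

Section Schemes.
Context {A : Type}.
Implicit Types (G : env A) (D : A -> Prop) (g h n : A -> nat).

Lemma comp_rec G D n g (h : A * nat * nat -> nat) :
  Comp G D n -> Comp G D g ->
  Comp (push (push G Nat) Nat) (fun p => D p.1.1) h ->
  Comp G D (fun a => nat_rect (fun=> nat) (g a) (fun m r => h (a, m, r)) (n a)).
Proof.
move=> cn [d Hd] [d' Hd'].
apply: (comp_let (h := fun p => nat_rect (fun=> nat) (g p.1)
  (fun m r => h (p.1, m, r)) p.2)) => //.
exists (CodeSeq.code [:: 5%N; d; d']) => -[a m] /= [Da _] {n cn}.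
elim: m => [|m IH] /=; first exact/eval_S5_0/Hd.
by apply: eval_S5_S IH _; exact: (Hd' (a, m, _)).
Qed.

Lemma comp_oracle t (psi : A -> pfunctional t) i ds (xs : A -> arguments t) G D g :
  (i < esize G)%N -> (forall a, D a -> nth (nent 0) (G a) i = pent (psi a)) ->
  (forall a, D a -> kevals ds (G a) (xs a)) ->
  (forall a, D a -> papply (psi a) (xs a) = Some (g a)) -> Comp G D g.
Proof.
move=> iG Gi Hds Hg; exists (CodeSeq.code [:: 8%N, i & ds]) => a Da.
have := @eval_S8 i ds (G a); rewrite Gi// esizeP.
by apply => //; [exact: Hds|exact: Hg].
Qed.

Lemma comp_var i G D g : (i < esize G)%N ->
  (forall a, D a -> nth (nent 0) (G a) i = nent (g a)) -> Comp G D g.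
Proof.
move=> iG Gi; apply: (@comp_oracle Nat (fun a => Some (g a)) i [::] (fun=> tt)) => //.
by move=> a _; exact: evals_nil.
Qed.

Lemma comp_apply1 (f : A -> functional baire) i G D n : (i < esize G)%N ->
  (forall a, D a -> nth (nent 0) (G a) i = tent (f a)) ->
  Comp G D n -> Comp G D (fun a => f a (n a)).
Proof.
move=> iG Gi [d Hd].
apply: (@comp_oracle baire (fun a => to_partial (f a)) i [:: d]
  (fun a => (n a, tt))) => // a Da.
apply: evals_cons; last exact: evals_nil.
by move=> -[]; exact: Hd.
Qed.

Lemma comp_applyB (F : A -> functional (baire ~> baire)) i G D n
    (b : A * nat -> nat) : (i < esize G)%N ->
  (forall a, D a -> nth (nent 0) (G a) i = tent (F a)) ->
  Comp (push G Nat) (fun p => D p.1) b ->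
  Comp G D n -> Comp G D (fun a => F a (fun k => b (a, k)) (n a)).
Proof.
move=> iG Gi [c Hc] [d Hd].
apply: (@comp_oracle (baire ~> baire) (fun a => to_partial (F a)) i [:: c; d]
  (fun a => ((fun k => b (a, k)), (n a, tt)))) => // a Da.
apply: evals_cons; first by move=> [k []]; exact: (Hc (a, k)).
apply: evals_cons; last exact: evals_nil.
by move=> -[]; exact: Hd.
Qed.

Lemma comp_apply2 (F : A -> functional (baire ~> Nat)) i G D (b : A * nat -> nat) :
  (i < esize G)%N ->
  (forall a, D a -> nth (nent 0) (G a) i = tent (F a)) ->
  Comp (push G Nat) (fun p => D p.1) b ->
  Comp G D (fun a => F a (fun k => b (a, k))).
Proof.
move=> iG Gi [c Hc].
apply: (@comp_oracle (baire ~> Nat) (fun a => to_partial (F a)) i [:: c]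
  (fun a => ((fun k => b (a, k)), tt))) => // a Da.
apply: evals_cons; last exact: evals_nil.
by move=> [k []]; exact: (Hc (a, k)).
Qed.

Lemma comp_E2 G D (b : A * nat -> nat) :
  Comp (push G Nat) (fun p => D p.1) b ->
  Comp G D (fun a => existsE2 (fun k => b (a, k))).
Proof.
move=> cb; apply: (comp_apply2 (F := fun=> existsE2) _ _ cb).
  exact: E2pos_lt.
by move=> a _; exact: E2posP.
Qed.

Lemma comp_applyO (Om : pfunctional ((baire ~> Nat) ~> baire)) i G D n g
    (c : A * functional baire -> nat) : (i < esize G)%N ->
  (forall a, D a -> nth (nent 0) (G a) i = pent Om) ->
  Comp (push G baire) (fun p => D p.1) c -> Comp G D n ->
  (forall a, D a -> Om (fun al => c (a, al)) (n a) = Some (g a)) ->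
  Comp G D g.
Proof.
move=> iG Gi [c' Hc] [d Hd] H.
apply: (@comp_oracle ((baire ~> Nat) ~> baire) (fun=> Om) i [:: c'; d]
  (fun a => ((fun al => c (a, al)), (n a, tt)))) => // a Da.
apply: evals_cons; first by move=> [k []]; exact: (Hc (a, k)).
apply: evals_cons; last exact: evals_nil.
by move=> -[]; exact: Hd.
Qed.

Lemma comp_applyP (Phi : pfunctional ((baire ~> baire) ~> baire)) i G D n g
    (c : A * nat * functional baire -> nat) : (i < esize G)%N ->
  (forall a, D a -> nth (nent 0) (G a) i = pent Phi) ->
  Comp (push (push G Nat) baire) (fun p => D p.1.1) c -> Comp G D n ->
  (forall a, D a -> Phi (fun al k => c (a, k, al)) (n a) = Some (g a)) ->
  Comp G D g.
Proof.
move=> iG Gi [c' Hc] [d Hd] H.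
apply: (@comp_oracle ((baire ~> baire) ~> baire) (fun=> Phi) i [:: c'; d]
  (fun a => ((fun al k => c (a, k, al)), (n a, tt)))) => // a Da.
apply: evals_cons; first by move=> [al [k []]]; exact: (Hc (a, k, al)).
apply: evals_cons; last exact: evals_nil.
by move=> -[]; exact: Hd.
Qed.

(* Running S5 on the branches would evaluate both of them. It selects the index of
   one of them instead, which is then run by S9. *)
Lemma comp_if G D (b : A -> bool) g h : Comp G D b ->
  Comp G (fun a => D a /\ b a) g -> Comp G (fun a => D a /\ ~ b a) h ->
  Comp G D (fun a => if b a then g a else h a).
Proof.
move=> cb [d Hd] [d' Hd'].
apply: (@comp_call _ _ _ (iota 0 (esize G)) (fun a => if b a then d else d')).
- apply: (comp_ext _
    (comp_rec (h := fun=> d) cb (comp_const G D d') (comp_const _ _ _))).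
  by move=> a _; case: (b a).
- exact: iota_uniq.
- by apply/allP => i; rewrite mem_iota.
- move=> a Da; rewrite -(esizeP G a) -/(mkseq _ _) mkseq_nth.
  by case: ifPn => [ba|/negP ba]; [exact: Hd|exact: Hd'].
Qed.

End Schemes.

(** * Arithmetic and arithmetical predicates *)

Ltac cvar := first [
  by apply: (@comp_var _ 0%N)
| by apply: (@comp_var _ 1%N)
| by apply: (@comp_var _ 2%N)
| by apply: (@comp_var _ 3%N)
| by apply: (@comp_var _ 4%N)
| by apply: (@comp_var _ 5%N)
| by apply: (@comp_var _ 6%N)
| by apply: (@comp_var _ 7%N)
| by apply: (@comp_var _ 8%N) ].

Definition Dec A (G : env A) D (P : A -> Prop) :=
  Comp G D (fun a => nat_of_bool `[< P a >]).

Definition Fun A (G : env A) D (al : A -> functional baire) :=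
  Comp (push G Nat) (fun p => D p.1) (fun p => al p.1 p.2).

Lemma comp_add A (G : env A) D m n : Comp G D m -> Comp G D n ->
  Comp G D (fun a => m a + n a)%N.
Proof.
move=> cm cn; apply: (comp_ext _ (comp_rec (h := fun p => p.2.+1) cm cn _)).
  by move=> a _; elim: (m a) => //= k ->.
by apply: comp_succ; cvar.
Qed.

Lemma comp_mul A (G : env A) D m n : Comp G D m -> Comp G D n ->
  Comp G D (fun a => m a * n a)%N.
Proof.
move=> cm cn; apply: (comp_ext _
  (comp_rec (h := fun p => n p.1.1 + p.2)%N cm (comp_const _ _ 0%N) _)).
  by move=> a _; elim: (m a) => //= k ->; rewrite mulSn.
by apply: comp_add; [exact: (comp_wk _ (comp_wk _ cn))|cvar].
Qed.

Lemma comp_exp A (G : env A) D m n : Comp G D m -> Comp G D n ->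
  Comp G D (fun a => m a ^ n a)%N.
Proof.
move=> cm cn; apply: (comp_ext _
  (comp_rec (h := fun p => m p.1.1 * p.2)%N cn (comp_const _ _ 1%N) _)).
  by move=> a _; elim: (n a) => //= k ->; rewrite expnS.
by apply: comp_mul; [exact: (comp_wk _ (comp_wk _ cm))|cvar].
Qed.

Lemma comp_pred A (G : env A) D n : Comp G D n -> Comp G D (fun a => (n a).-1).
Proof.
move=> cn; apply: (comp_ext _
  (comp_rec (h := fun p => p.1.2)%N cn (comp_const _ _ 0%N) _)).
  by move=> a _; case: (n a).
by cvar.
Qed.

Lemma comp_sub A (G : env A) D m n : Comp G D m -> Comp G D n ->
  Comp G D (fun a => m a - n a)%N.
Proof.
move=> cm cn; apply: (comp_ext _ (comp_rec (h := fun p => p.2.-1)%N cn cm _)).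
  by move=> a _; elim: (n a) => //= [|k ->]; rewrite ?subn0// subnS.
by apply: comp_pred; cvar.
Qed.

Lemma comp_eq0 A (G : env A) D n :
  Comp G D n -> Comp G D (fun a => nat_of_bool (n a == 0%N)).
Proof.
move=> cn; apply: (comp_ext _
  (comp_rec (h := fun=> 0%N) cn (comp_const _ _ 1%N) (comp_const _ _ 0%N))).
by move=> a _; case: (n a).
Qed.

Lemma dec_ext A (G : env A) D (P Q : A -> Prop) :
  (forall a, D a -> P a <-> Q a) -> Dec G D P -> Dec G D Q.
Proof. by move=> PQ; apply: comp_ext => a /PQ /propext ->. Qed.

Lemma dec_leq A (G : env A) D m n :
  Comp G D m -> Comp G D n -> Dec G D (fun a => m a <= n a)%N.
Proof.
move=> cm cn; apply: (comp_ext _ (comp_eq0 (comp_sub cm cn))) => a _.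
by rewrite subn_eq0 asboolb.
Qed.

Lemma dec_not A (G : env A) D (P : A -> Prop) : Dec G D P -> Dec G D (fun a => ~ P a).
Proof.
by move/comp_eq0; apply: comp_ext => a _; rewrite asbool_neg; case: asboolP.
Qed.

Lemma dec_and A (G : env A) D (P Q : A -> Prop) :
  Dec G D P -> Dec G D Q -> Dec G D (fun a => P a /\ Q a).
Proof.
move=> cP cQ; apply: (comp_ext _ (comp_mul cP cQ)) => a _.
by rewrite asbool_and; do 2 case: asboolP.
Qed.

Lemma dec_or A (G : env A) D (P Q : A -> Prop) :
  Dec G D P -> Dec G D Q -> Dec G D (fun a => P a \/ Q a).
Proof.
move=> /dec_not cP /dec_not cQ; apply: (dec_ext _ (dec_not (dec_and cP cQ))).
by move=> a _; rewrite not_andE !notK.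
Qed.

Lemma dec_imply A (G : env A) D (P Q : A -> Prop) :
  Dec G D P -> Dec G D Q -> Dec G D (fun a => P a -> Q a).
Proof.
move=> cP cQ; apply: (dec_ext _ (dec_or (dec_not cP) cQ)) => a _.
by rewrite implyE.
Qed.

Lemma dec_eq A (G : env A) D m n :
  Comp G D m -> Comp G D n -> Dec G D (fun a => m a = n a).
Proof.
move=> cm cn; apply: (dec_ext _ (dec_and (dec_leq cm cn) (dec_leq cn cm))).
move=> a _; split=> [[mn nm]|->//].
by apply/eqP; rewrite eqn_leq mn.
Qed.

Lemma dec_exists A (G : env A) D (P : A -> nat -> Prop) :
  Dec (push G Nat) (fun p => D p.1) (fun p => P p.1 p.2) ->
  Dec G D (fun a => exists n, P a n).
Proof.
(* [existsE2] searches for a zero, hence the negation. *)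
move=> /dec_not cP.
apply: (comp_ext _ (comp_eq0
  (comp_E2 (b := fun p => nat_of_bool `[< ~ P p.1 p.2 >]) cP))).
move=> a _; rewrite /existsE2; congr nat_of_bool; case: asboolP => [[n /= Pn]|nP].
  by apply/esym/asboolP; exists n; move: Pn; case: asboolP => // /contrapT.
by apply/esym/asboolPn => -[n Pn]; apply: nP; exists n; case: asboolP.
Qed.

Lemma dec_forall A (G : env A) D (P : A -> nat -> Prop) :
  Dec (push G Nat) (fun p => D p.1) (fun p => P p.1 p.2) ->
  Dec G D (fun a => forall n, P a n).
Proof.
move=> /dec_not/(dec_exists (P := fun a n => ~ P a n))/dec_not; apply: dec_ext => a _.
by split=> [H n|H [n]]//; apply: contrapT => Pn; apply: H; exists n.
Qed.

Lemma comp_at A (G : env A) D (al : A -> functional baire) n :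
  Fun G D al -> Comp G D n -> Comp G D (fun a => al a (n a)).
Proof.
move=> cal cn; apply: (comp_let (h := fun p => al p.1 p.2) cn).
by apply: comp_dom cal => ? [].
Qed.

(** Weakening below the top entry, for functional arguments that are built under one more
    parameter. *)
Lemma comp_wk2 A (G : env A) D s t (g : A * functional t -> nat) :
  Comp (push G t) (fun p => D p.1) g ->
  Comp (push (push G s) t) (fun p => D p.1.1) (fun p => g (p.1.1, p.2)).
Proof.
pose r := 0%N :: [seq i.+2 | i <- iota 0 (esize G)].
apply: (@comp_rename _ _ (push G t) (fun p => D p.1)
  (fun p : A * functional s * functional t => (p.1.1, p.2)) r) => //.
- rewrite /= map_inj_uniq ?iota_uniq ?andbT; last by move=> ? ? [].
  by apply/mapP => -[].
- apply/allP => i; rewrite inE => /predU1P[->//|/mapP[j]].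
  by rewrite mem_iota => ? ->.
- move=> [[a x] y] _ /=; congr (_ :: _).
  by rewrite -map_comp -(esizeP G a) -[in LHS](mkseq_nth (nent 0) (G a)).
Qed.

Lemma fun_wk A (G : env A) D (al : A -> functional baire) s : Fun G D al ->
  Fun (push G s) (fun p => D p.1) (fun p => al p.1).
Proof. by move=> cal; exact: (comp_wk2 s cal). Qed.

Lemma comp_sum A (G : env A) (D : A -> Prop) n (b : A -> nat -> nat) :
  Comp G D n -> Comp (push G Nat) (fun p => D p.1) (fun p => b p.1 p.2) ->
  Comp G D (fun a => \sum_(j < n a) b a j)%N.
Proof.
move=> cn cb; apply: (comp_ext _
  (comp_rec (h := fun p => p.2 + b p.1.1 p.1.2)%N cn (comp_const _ _ 0%N) _)).
  by move=> a _; elim: (n a) => [|k /= ->]; rewrite ?big_ord0// big_ord_recr.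
by apply: comp_add; [cvar|exact: (comp_wk _ cb)].
Qed.

(** Counting the thresholds below a number recovers it from comparisons alone; [search_approx] and
    [snd_code] obtain their values in this way. *)
Lemma sum_ltn M n : (\sum_(j < M) (j < n) = minn M n)%N.
Proof.
elim: M => [|M IH]; first by rewrite big_ord0 min0n.
rewrite big_ord_recr/= IH; case: (ltnP M n) => h; last first.
  by rewrite addn0 (minn_idPr (leqW h)).
by rewrite addn1; apply/esym/minn_idPl.
Qed.

Local Open Scope classical_set_scope.
Local Open Scope ring_scope.
Local Notation q := rat_of_code.

(** * Decidability of comparisons between codes of reals *)

(** The step of three matches the quantifiers over fractions (a, b, c) below. *)
Ltac cwk H := first
  [ exact: H | exact: (comp_wk _ H)
  | let H' := fresh in
    have H' := comp_wk Nat (comp_wk Nat (comp_wk Nat H)); cwk H' ].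

(** The formula is the cons step of [CodeSeq.code], so codes of lists unfold to it by conversion. *)
Lemma comp_code_cons A (G : env A) D m n : Comp G D m -> Comp G D n ->
  Comp G D (fun a => 2 ^ m a * (n a).*2.+1)%N.
Proof.
move=> cm cn; apply: comp_mul; first exact/comp_exp/cm/comp_const.
apply/comp_succ/(comp_ext _ (comp_mul (comp_const _ _ 2) cn)) => a _.
by rewrite mul2n.
Qed.

Lemma comp_code2 A (G : env A) D m n : Comp G D m -> Comp G D n ->
  Comp G D (fun a => CodeSeq.code [:: m a; n a]).
Proof. by move=> cm cn; exact/comp_code_cons/comp_code_cons/comp_const. Qed.

Lemma comp_code3 A (G : env A) D k m n : Comp G D k -> Comp G D m -> Comp G D n ->
  Comp G D (fun a => CodeSeq.code [:: k a; m a; n a]).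
Proof.
by move=> ck cm cn; exact/comp_code_cons/comp_code_cons/comp_code_cons/comp_const.
Qed.

Lemma rat_of_code3 a b c : q (CodeSeq.code [:: a; b; c]) = (a%:R - b%:R) / c.+1%:R.
Proof. by rewrite /q CodeSeq.codeK. Qed.

Lemma rat_of_code_surj r : exists i, q i = r.
Proof.
case: (ratP r) => n d _; case: n => n.
  by exists (CodeSeq.code [:: n; 0; d]); rewrite rat_of_code3 subr0.
by exists (CodeSeq.code [:: 0; n.+1; d]); rewrite rat_of_code3 sub0r NegzE mulrNz.
Qed.

(* Codes of length other than 3 represent 0. *)
Definition fraction_of_code (i a b c : nat) :=
  CodeSeq.code [:: a; b; c] = i \/
  [/\ ~ (exists a b c, CodeSeq.code [:: a; b; c] = i), a = 0%N, b = 0%N & c = 0%N].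

Lemma fraction_of_codeE i a b c : fraction_of_code i a b c ->
  q i = (a%:R - b%:R) / c.+1%:R.
Proof.
case=> [<-|[ni -> -> ->]]; first exact: rat_of_code3.
rewrite subr0 mul0r /q; move: ni; rewrite -{1}(CodeSeq.decodeK i).
by case: CodeSeq.decode => [|a' [|b' [|c' [|]]]] // []; exists a', b', c'.
Qed.

Lemma fraction_of_code_ex i : exists a b c, fraction_of_code i a b c.
Proof.
have [[a [b [c abc]]]|ni] := pselect (exists a b c, CodeSeq.code [:: a; b; c] = i).
  by exists a, b, c; left.
by exists 0%N, 0%N, 0%N; right.
Qed.

(** Codes are inverted by quantifying over triples, so only the coding has to be computed and not
    the decoding. *)
Lemma dec_fraction A (G : env A) D i a b c :
  Comp G D i -> Comp G D a -> Comp G D b -> Comp G D c ->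
  Dec G D (fun x => fraction_of_code (i x) (a x) (b x) (c x)).
Proof.
move=> ci ca cb cc; apply: dec_or; first exact/dec_eq/ci/comp_code3.
suff: Dec G D (fun x => ~ (exists a b c, CodeSeq.code [:: a; b; c] = i x) /\
   [/\ a x = 0%N, b x = 0%N & c x = 0%N]).
  by apply: dec_ext => x _; split=> [[? []]|[? ? ? ?]].
apply: dec_and.
  apply: dec_not; do 3! apply: dec_exists; apply: dec_eq; last by cwk ci.
  by apply: comp_code3; [cvar|cvar|cvar].
suff: Dec G D (fun x => a x = 0%N /\ (b x = 0%N /\ c x = 0%N)).
  by apply: dec_ext => x _; split=> [[? []]|[]].
by do 2 ?apply: dec_and; apply: dec_eq => //; exact: comp_const.
Qed.

(** Denominators are cleared and subtracted terms change sides, which leaves sums and products of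
    naturals. *)
Lemma fraction_lt (a b c a' b' c' a'' b'' c'' : nat) :
  ((a%:R - b%:R) / c.+1%:R < (a'%:R - b'%:R) / c'.+1%:R +
     (a''%:R - b''%:R) / c''.+1%:R :> rat) =
  (a * c'.+1 * c''.+1 + b' * c.+1 * c''.+1 + b'' * c.+1 * c'.+1 <
   a' * c.+1 * c''.+1 + a'' * c.+1 * c'.+1 + b * c'.+1 * c''.+1)%N.
Proof.
rewrite -(ltr_nat rat) -[LHS]subr_gt0 -[RHS]subr_gt0 !natrD !natrM.
move: (c.+1%:R : rat) (c'.+1%:R : rat) (c''.+1%:R : rat)
  (ltr0Sn rat c) (ltr0Sn rat c') (ltr0Sn rat c'') => x y z x0 y0 z0.
rewrite -[RHS](@pmulr_lgt0 _ (x * y * z)^-1); last by rewrite invr_gt0 !mulr_gt0.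
congr (0 < _); field.
by rewrite !gt_eqF.
Qed.

(** All predicates on codes of reals reduce to this comparison; the last summand carries an error
    [2 ^- n], its opposite, or 0. *)
Lemma dec_rat_lt A (G : env A) D i j k :
  Comp G D i -> Comp G D j -> Comp G D k ->
  Dec G D (fun x => q (i x) < q (j x) + q (k x)).
Proof.
move=> ci cj ck.
suff: Dec G D (fun x => exists a b c, fraction_of_code (i x) a b c /\
  exists a' b' c', fraction_of_code (j x) a' b' c' /\
  exists a'' b'' c'', fraction_of_code (k x) a'' b'' c'' /\
  ((a * c'.+1 * c''.+1 + b' * c.+1 * c''.+1 + b'' * c.+1 * c'.+1).+1 <=
   a' * c.+1 * c''.+1 + a'' * c.+1 * c'.+1 + b * c'.+1 * c''.+1)%N).
  apply: dec_ext => x _; split.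
    move=> [a [b [c [/fraction_of_codeE -> [a' [b' [c' [/fraction_of_codeE ->]]]]]]]].
    move=> [a'' [b'' [c'' [/fraction_of_codeE ->]]]].
    by rewrite fraction_lt.
  have [a [b [c abc]]] := fraction_of_code_ex (i x).
  have [a' [b' [c' abc']]] := fraction_of_code_ex (j x).
  have [a'' [b'' [c'' abc'']]] := fraction_of_code_ex (k x).
  rewrite (fraction_of_codeE abc) (fraction_of_codeE abc') (fraction_of_codeE abc'').
  rewrite fraction_lt => H.
  by exists a, b, c; split=> //; exists a', b', c'; split=> //; exists a'', b'', c''.
do 3! apply: dec_exists; apply: dec_and.
  by apply: dec_fraction; [cwk ci|cvar|cvar|cvar].
do 3! apply: dec_exists; apply: dec_and.
  by apply: dec_fraction; [cwk cj|cvar|cvar|cvar].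
do 3! apply: dec_exists; apply: dec_and.
  by apply: dec_fraction; [cwk ck|cvar|cvar|cvar].
by apply: dec_leq; [apply: comp_succ|];
  repeat first [apply: comp_add|apply: comp_mul|apply: comp_succ|cvar].
Qed.

Definition pow2_code n := CodeSeq.code [:: 1; 0; (2 ^ n).-1]%N.
Definition oppow2_code n := CodeSeq.code [:: 0; 1; (2 ^ n).-1]%N.

Lemma rat_pow2_code n : q (pow2_code n) = 2 ^- n.
Proof. by rewrite rat_of_code3 subr0 div1r prednK ?expn_gt0// natrX. Qed.

Lemma rat_oppow2_code n : q (oppow2_code n) = - 2 ^- n.
Proof. by rewrite rat_of_code3 sub0r mulN1r prednK ?expn_gt0// natrX. Qed.

Lemma comp_pow2_code A (G : env A) (D : A -> Prop) n :
  Comp G D n -> Comp G D (fun a => pow2_code (n a)).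
Proof.
move=> cn; apply: comp_code3; [exact: comp_const..|].
exact/comp_pred/comp_exp/cn/comp_const.
Qed.

Lemma comp_oppow2_code A (G : env A) (D : A -> Prop) n :
  Comp G D n -> Comp G D (fun a => oppow2_code (n a)).
Proof.
move=> cn; apply: comp_code3; [exact: comp_const..|].
exact/comp_pred/comp_exp/cn/comp_const.
Qed.

(* The predicates below are arithmetical in codes of reals; the real numbers
   that they compare are given by the lemmas [code_ltP], [code_nearP], etc. *)
Definition fast_cauchy (al : functional baire) :=
  forall n i, q (al n) < q (al (n + i)%N) + q (pow2_code n) /\
              q (al (n + i)%N) < q (al n) + q (pow2_code n).
Definition code_below (al : functional baire) r :=
  exists n, q (al n) < q r + q (oppow2_code n).
Definition code_above (al : functional baire) r :=
  exists n, q r < q (al n) + q (oppow2_code n).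
Definition code_lt al be := exists r, code_below al r /\ code_above be r.
Definition code_near al r n := exists s t,
  (q s < q r + q (pow2_code n) /\ code_below al s) /\
  (q r < q t + q (pow2_code n) /\ code_above al t).
Definition code_far k al be := exists s t,
  ~ (q t < q s + q (pow2_code k)) /\
  ((code_below al s /\ code_above be t) \/ (code_below be s /\ code_above al t)).
(** The number 0 codes the rational 0, and [pow2_code 0] codes 1. *)
Definition code_01 al := ~ code_below al 0%N /\ ~ code_above al (pow2_code 0).
Definition rat_01 r := ~ (q r < q 0%N + q 0%N) /\ ~ (q (pow2_code 0) < q r + q 0%N).
(** A rational is passed to [F] as a constant sequence, so that number quantifiers suffice. *)
Definition code_jump (F : functional (baire ~> baire)) k al :=
  forall n, exists r, rat_01 r /\ code_near al r n /\
    code_far k (F (fun=> r)) (F al).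
Definition code_discont F al :=
  fast_cauchy al /\ code_01 al /\ exists k, code_jump F k al.
Definition code_prec F al be :=
  (exists k, code_jump F k al /\ ~ code_jump F k be) \/
  ((forall k, code_jump F k be -> code_jump F k al) /\ code_lt al be).

(** Functionals such as [F] are looked up among the arguments instead of being computed, so a
    position is recorded. *)
Definition Var A (G : env A) (D : A -> Prop) s (x : A -> functional s) :=
  exists2 i, (i < esize G)%N & forall a, D a -> nth (nent 0) (G a) i = tent (x a).

Lemma var_wk A (G : env A) (D : A -> Prop) s x t : @Var A G D s x ->
  Var (push G t) (fun p => D p.1) (fun p => x p.1).
Proof. by move=> [i iG Gi]; exists i.+1 => // a Da; exact: Gi. Qed.

Lemma var_top A (G : env A) s D : Var (push G s) D (fun p => p.2).
Proof. by exists 0%N. Qed.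

Lemma fun_var A (G : env A) (D : A -> Prop) x : @Var A G D baire x -> Fun G D x.
Proof.
move/(var_wk Nat) => [i iG Gi].
by apply: (comp_apply1 (f := fun p => x p.1) iG Gi); cvar.
Qed.

Lemma fun_apply A (G : env A) (D : A -> Prop) F (al : A -> functional baire) :
  @Var A G D (baire ~> baire) F -> Fun G D al -> Fun G D (fun a => F a (al a)).
Proof.
move=> /(var_wk Nat) [i iG Gi] /(fun_wk Nat) cal.
apply: (comp_applyB (F := fun p => F p.1) (b := fun p => al p.1.1 p.2) iG Gi) => //.
by cvar.
Qed.

Section Dec.
Context {A : Type} {G : env A} {D : A -> Prop}.
Implicit Types (al be : A -> functional baire).

Lemma dec_fast_cauchy al : Fun G D al -> Dec G D (fun a => fast_cauchy (al a)).
Proof.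
move=> cal; do 2 apply: dec_forall.
have c1 := fun_wk Nat (fun_wk Nat cal).
have cn : Comp (push (push G Nat) Nat) (fun p => D p.1.1) (fun p => p.1.2) by cvar.
have ca := comp_at c1 cn.
have ci : Comp (push (push G Nat) Nat) (fun p => D p.1.1) (fun p => p.1.2 + p.2)%N.
  by apply: comp_add; cvar.
have cai := comp_at c1 ci.
by apply: dec_and; apply: dec_rat_lt => //; exact: comp_pow2_code.
Qed.

Lemma dec_below al r : Fun G D al -> Comp G D r ->
  Dec G D (fun a => code_below (al a) (r a)).
Proof.
move=> cal cr; apply: dec_exists.
apply: dec_rat_lt; [exact: cal|exact: comp_wk cr|].
by apply: comp_oppow2_code; cvar.
Qed.

Lemma dec_above al r : Fun G D al -> Comp G D r ->
  Dec G D (fun a => code_above (al a) (r a)).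
Proof.
move=> cal cr; apply: dec_exists.
apply: dec_rat_lt; [exact: comp_wk cr|exact: cal|].
by apply: comp_oppow2_code; cvar.
Qed.

Lemma dec_rat_01 r : Comp G D r -> Dec G D (fun a => rat_01 (r a)).
Proof.
by move=> cr; apply: dec_and; apply/dec_not/dec_rat_lt => //; exact: comp_const.
Qed.
End Dec.

Section Dec.
Context {A : Type} {G : env A} {D : A -> Prop}.
Implicit Types (al be : A -> functional baire).

Lemma dec_lt al be : Fun G D al -> Fun G D be ->
  Dec G D (fun a => code_lt (al a) (be a)).
Proof.
move=> /(fun_wk Nat) cal /(fun_wk Nat) cbe; apply: dec_exists; apply: dec_and.
  by apply: dec_below => //; cvar.
by apply: dec_above => //; cvar.
Qed.

Lemma dec_near al r n : Fun G D al -> Comp G D r -> Comp G D n ->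
  Dec G D (fun a => code_near (al a) (r a) (n a)).
Proof.
move=> cal /(comp_wk Nat)/(comp_wk Nat) cr /(comp_wk Nat)/(comp_wk Nat) cn.
have {}cal := fun_wk Nat (fun_wk Nat cal).
have cp := comp_pow2_code cn.
do 2 apply: dec_exists; apply: dec_and; apply: dec_and.
- by apply: dec_rat_lt => //; cvar.
- by apply: dec_below => //; cvar.
- by apply: dec_rat_lt => //; cvar.
- by apply: dec_above => //; cvar.
Qed.

Lemma dec_far al be k : Fun G D al -> Fun G D be -> Comp G D k ->
  Dec G D (fun a => code_far (k a) (al a) (be a)).
Proof.
move=> cal cbe /(comp_wk Nat)/(comp_wk Nat)/comp_pow2_code ck.
have {}cal := fun_wk Nat (fun_wk Nat cal).
have {}cbe := fun_wk Nat (fun_wk Nat cbe).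
do 2 apply: dec_exists; apply: dec_and.
  by apply: dec_not; apply: dec_rat_lt => //; cvar.
apply: dec_or; apply: dec_and.
- by apply: dec_below => //; cvar.
- by apply: dec_above => //; cvar.
- by apply: dec_below => //; cvar.
- by apply: dec_above => //; cvar.
Qed.

Lemma dec_01 al : Fun G D al -> Dec G D (fun a => code_01 (al a)).
Proof.
move=> cal; apply: dec_and; apply: dec_not.
  exact/dec_below/comp_const.
exact/dec_above/comp_const.
Qed.
End Dec.

Lemma dec_jump A (G : env A) (D : A -> Prop) F al k :
  Var G D F -> Fun G D al -> Comp G D k ->
  Dec G D (fun a => code_jump (F a) (k a) (al a)).
Proof.
move=> /(var_wk Nat)/(var_wk Nat) cF cal /(comp_wk Nat)/(comp_wk Nat) ck.
have {}cal := fun_wk Nat (fun_wk Nat cal).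
apply: dec_forall; apply: dec_exists; apply: dec_and; first by apply: dec_rat_01; cvar.
apply: dec_and; first by apply: dec_near => //; cvar.
apply: dec_far => //; last exact: (fun_apply cF cal).
by apply: (fun_apply (al := fun p _ => p.2) cF); cvar.
Qed.

Lemma dec_discont A (G : env A) (D : A -> Prop) F al : Var G D F -> Fun G D al ->
  Dec G D (fun a => code_discont (F a) (al a)).
Proof.
move=> cF cal; apply: dec_and; first exact: dec_fast_cauchy.
apply: dec_and; first exact: dec_01.
apply: dec_exists; apply: dec_jump; [exact: var_wk|exact: fun_wk|cvar].
Qed.

Lemma dec_prec A (G : env A) (D : A -> Prop) F al be :
  Var G D F -> Fun G D al -> Fun G D be ->
  Dec G D (fun a => code_prec (F a) (al a) (be a)).
Proof.
move=> cF cal cbe.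
have jump ga : Fun G D ga ->
    Dec (push G Nat) (fun p => D p.1) (fun p => code_jump (F p.1) p.2 (ga p.1)).
  by move=> cga; apply: dec_jump; [exact: var_wk|exact: fun_wk|cvar].
apply: dec_or.
  by apply: dec_exists; apply: dec_and; [|apply: dec_not]; exact: jump.
apply: dec_and; last exact: dec_lt.
by apply: dec_forall; apply: dec_imply; exact: jump.
Qed.

(** * Codes and the reals they denote *)

Section CodedReals.
Context {R : realType}.
Implicit Types (x y : R) (al be : functional baire) (f : R -> R).

Lemma exists_pow2_lt (e : R) : 0 < e -> exists n, 2 ^- n < e.
Proof.
move=> e0; exists (Num.bound e^-1).
rewrite -[ltRHS]invrK ltf_pV2 ?posrE ?exprn_gt0 ?invr_gt0//.
apply: (lt_le_trans (archi_boundP _)); first by rewrite invr_ge0 ltW.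
by rewrite -natrX ler_nat ltnW// ltn_expl.
Qed.

Lemma ratr_pow2_code n : ratr (q (pow2_code n)) = 2 ^- n :> R.
Proof. by rewrite rat_pow2_code fmorphV rmorphXn/= ratr_nat. Qed.

Lemma ratr_oppow2_code n : ratr (q (oppow2_code n)) = - 2 ^- n :> R.
Proof. by rewrite rat_oppow2_code rmorphN/= fmorphV rmorphXn/= ratr_nat. Qed.

Lemma ratr_ltD i j k : (q i < q j + q k) =
  (ratr (q i) < ratr (q j) + ratr (q k) :> R).
Proof. by rewrite -rmorphD ltr_rat. Qed.

Lemma fast_cauchyE al : fast_cauchy al <->
  forall n i, `|q (al n) - q (al (n + i)%N)| < 2%:R ^- n.
Proof.
split=> H n i; have := H n i; rewrite rat_pow2_code.
  by case=> h1 h2; rewrite ltr_norml; apply/andP; split; lra.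
by rewrite ltr_norml => /andP[h1 h2]; split; lra.
Qed.

Lemma codes_real_fast_cauchy al x : codes_real al x -> fast_cauchy al.
Proof. by case=> /fast_cauchyE. Qed.

Lemma fast_cauchy_codes al : fast_cauchy al -> exists x, codes_real al x.
Proof.
move=> /fast_cauchyE H.
suff /cvg_ex[x xP] : cvgn (fun n => ratr (q (al n)) : R) by exists x.
apply/cauchy_cvgP/cauchy_exP => e e0.
have [n ne] := exists_pow2_lt e0.
exists (ratr (q (al n))); exists n => // m /= nm.
rewrite -ball_normE /ball_ /= -rmorphB -ratr_norm.
apply: lt_trans ne; rewrite -(subnKC nm) -ratr_pow2_code ltr_rat rat_pow2_code.
exact: H.
Qed.

Lemma codes_real_dist al x n : codes_real al x -> `|ratr (q (al n)) - x| <= 2 ^- n.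
Proof.
move=> [H cx].
have c : (fun m => `|ratr (q (al n)) - ratr (q (al m))| : R) @ \oo -->
    `|ratr (q (al n)) - x|.
  by apply: cvg_norm; apply: cvgB => //; exact: cvg_cst.
apply: (cvgr_to_le c); exists n => // m /= nm.
rewrite -rmorphB -ratr_norm -(subnKC nm) -ratr_pow2_code ler_rat rat_pow2_code.
exact/ltW/H.
Qed.

Lemma codes_real_rat r : codes_real (fun=> r) (ratr (q r) : R).
Proof. by split; [move=> n i; rewrite subrr normr0|exact: cvg_cst]. Qed.

(** Two errors of this size add up to at most [2 ^- n.+1], which leaves room for the strict bound in
    the definition of a fast Cauchy sequence. *)
Lemma codes_real_approx al x : (forall n, `|ratr (q (al n)) - x| <= 2 ^- n.+2) ->
  codes_real al x.
Proof.
move=> H.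
suff fc : fast_cauchy al.
  have [y cy] := fast_cauchy_codes fc.
  suff -> : x = y by [].
  apply/eqP; rewrite -subr_eq0 -normr_le0; apply/ler_addgt0Pl => e e0.
  have [n ne] := exists_pow2_lt e0; rewrite addr0.
  apply: le_trans (ltW ne); have := codes_real_dist n.+1 cy.
  have := H n.+1; rewrite !ler_norml !exprS; have : 0 < 2 ^- n :> R by [].
  set a := ratr _; rewrite !invfM; move=> a0 /andP[h1 h2] /andP[h3 h4].
  by apply/andP; split; lra.
move=> n i; rewrite !(ratr_ltD) ratr_pow2_code.
have := H n; have := H (n + i)%N.
have : 2 ^- (n + i) <= 2 ^- n :> R.
  by rewrite lef_pV2 ?posrE// ler_weXn2l ?leq_addr// ler1n.
rewrite !ler_norml !exprS !invfM => l /andP[h1 h2] /andP[h3 h4].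
have l0 : 0 < 2 ^- (n + i) :> R by [].
by split; lra.
Qed.

Section Comparisons.
Variables (al be : functional baire) (x y : R).
Hypotheses (cx : codes_real al x) (cy : codes_real be y).

Lemma code_belowP r : code_below al r <-> x < ratr (q r).
Proof.
split=> [[n]|xr].
  rewrite ratr_ltD ratr_oppow2_code; have := codes_real_dist n cx.
  by rewrite ler_norml => /andP[h1 h2] h3; lra.
have /exists_pow2_lt[n ne] : 0 < (ratr (q r) - x) / 2.
  by rewrite divr_gt0// subr_gt0.
exists n; rewrite ratr_ltD ratr_oppow2_code; have := codes_real_dist n cx.
by rewrite ler_norml => /andP[h1 h2]; lra.
Qed.

Lemma code_aboveP r : code_above al r <-> ratr (q r) < x.
Proof.
split=> [[n]|xr].
  rewrite ratr_ltD ratr_oppow2_code; have := codes_real_dist n cx.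
  by rewrite ler_norml => /andP[h1 h2] h3; lra.
have /exists_pow2_lt[n ne] : 0 < (x - ratr (q r)) / 2.
  by rewrite divr_gt0// subr_gt0.
exists n; rewrite ratr_ltD ratr_oppow2_code; have := codes_real_dist n cx.
by rewrite ler_norml => /andP[h1 h2]; lra.
Qed.

Lemma exists_rat_code (a b : R) : a < b ->
  exists r, a < ratr (q r) /\ ratr (q r) < b.
Proof.
move=> /rat_in_itvoo[s]; have [r <-] := rat_of_code_surj s.
by rewrite in_itv/= => /andP[]; exists r.
Qed.

Lemma code_01P : code_01 al <-> 0 <= x <= 1.
Proof.
rewrite /code_01 code_belowP code_aboveP ratr_pow2_code invr1.
rewrite (_ : q 0 = 0)// rmorph0; split=> [[/negP + /negP]|/andP[]].
  by rewrite -!leNgt => -> ->.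
by rewrite !leNgt => /negP + /negP.
Qed.
End Comparisons.

Section Comparisons.
Variables (al be : functional baire) (x y : R).
Hypotheses (cx : codes_real al x) (cy : codes_real be y).

Lemma code_ltP : code_lt al be <-> x < y.
Proof.
split=> [[r [/(code_belowP cx) xr /(code_aboveP cy)]]|].
  exact: lt_trans.
move=> /exists_rat_code[r [xr ry]]; exists r.
by rewrite (code_belowP cx) (code_aboveP cy).
Qed.

Lemma code_nearP r n : code_near al r n <-> `|ratr (q r) - x| < 2 ^- n.
Proof.
rewrite ltr_norml; split.
  move=> [s [t []]]; rewrite !ratr_ltD (code_belowP cx) (code_aboveP cx).
  rewrite ratr_pow2_code => -[h1 h2] [h3 h4].
  by apply/andP; split; lra.
move=> /andP[h1 h2].
have /exists_rat_code[s [xs sr]] : x < ratr (q r) + 2 ^- n by lra.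
have /exists_rat_code[t [rt tx]] : ratr (q r) - 2 ^- n < x by lra.
exists s, t; rewrite !ratr_ltD (code_belowP cx) (code_aboveP cx) ratr_pow2_code.
by do ! split; lra.
Qed.

Lemma code_farP k : code_far k al be <-> 2 ^- k < `|x - y|.
Proof.
rewrite ltr_normr; split.
  move=> [s [t []]]; rewrite ratr_ltD ratr_pow2_code => /negP; rewrite -leNgt => st.
  rewrite (code_belowP cx) (code_belowP cy) (code_aboveP cx) (code_aboveP cy).
  by case=> -[h1 h2]; apply/orP; [right|left]; lra.
case/orP => h.
  have /exists_rat_code[s [ys sx]] : y < x - 2 ^- k by lra.
  have /exists_rat_code[t [st tx]] : ratr (q s) + 2 ^- k < x by lra.
  exists s, t; rewrite ratr_ltD ratr_pow2_code; split; first by apply/negP; lra.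
  by right; rewrite (code_belowP cy) (code_aboveP cx).
have /exists_rat_code[s [ys sx]] : x < y - 2 ^- k by lra.
have /exists_rat_code[t [st tx]] : ratr (q s) + 2 ^- k < y by lra.
exists s, t; rewrite ratr_ltD ratr_pow2_code; split; first by apply/negP; lra.
by left; rewrite (code_belowP cx) (code_aboveP cy).
Qed.
End Comparisons.

Lemma rat_01P r : rat_01 r <-> 0 <= (ratr (q r) : R) <= 1.
Proof.
rewrite /rat_01 !ratr_ltD ratr_pow2_code (_ : q 0 = 0)// rmorph0 !addr0 expr0 invr1.
split=> [[/negP + /negP]|/andP[]].
  by rewrite -!leNgt => -> ->.
by rewrite !leNgt => /negP + /negP.
Qed.

Definition jump f k x := 0 <= x <= 1 /\ forall n, exists r : rat,
  [/\ 0 <= (ratr r : R) <= 1, `|ratr r - x| < 2 ^- n & 2 ^- k < `|f (ratr r) - f x|].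

Definition discont f x := exists k, jump f k x.

(** Since [jump f k x] is monotone in [k], this is the lexicographic order by least level and then
    position. The second disjunct also admits a smaller level at [x], which the first one covers
    already. *)
Definition prec f x y := (exists k, jump f k x /\ ~ jump f k y) \/
  ((forall k, jump f k y -> jump f k x) /\ x < y).

Section Codes.
Variables (F : functional (baire ~> baire)) (f : R -> R).
Hypothesis Ff : codes_fun F f.

Lemma code_jumpP al x k : 0 <= x <= 1 -> codes_real al x ->
  code_jump F k al <-> jump f k x.
Proof.
move=> x01 cx; have cF := Ff x01 cx; split=> [H|[_ H]].
  split=> // n; have [r [/rat_01P r01 [/(code_nearP cx) rx]]] := H n.
  rewrite (code_farP (Ff r01 (codes_real_rat r)) cF) => far.
  by exists (q r).
move=> n; have [s [s01 sx far]] := H n; have [r rs] := rat_of_code_surj s.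
rewrite -rs in s01 sx far.
exists r; split; first by apply/rat_01P.
split; first by apply/(code_nearP cx).
by apply/(code_farP (Ff s01 (codes_real_rat r)) cF).
Qed.

Lemma code_discontP al x : codes_real al x -> code_discont F al <-> discont f x.
Proof.
move=> cx; rewrite /code_discont (code_01P cx); split.
  by move=> [_ [x01 [k /(code_jumpP k x01 cx)]]]; exists k.
move=> [k jk]; have [x01 _] := jk; split; first exact: codes_real_fast_cauchy cx.
by split=> //; exists k; apply/(code_jumpP k x01 cx).
Qed.

Lemma code_precP al be x y : 0 <= x <= 1 -> 0 <= y <= 1 ->
  codes_real al x -> codes_real be y -> code_prec F al be <-> prec f x y.
Proof.
move=> x01 y01 cx cy; rewrite /code_prec /prec (code_ltP cx cy).
have Px k := propext (code_jumpP k x01 cx); have Py k := propext (code_jumpP k y01 cy).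
by under eq_exists do rewrite Px Py; under eq_forall do rewrite Px Py.
Qed.
End Codes.

End CodedReals.

(** * The well-order of the points of discontinuity *)

Section Precedence.
Context {R : realType}.
Implicit Types (f : R -> R) (x y z : R).

Lemma prec_total f x y : x != y -> prec f x y \/ prec f y x.
Proof.
wlog xy : x y / x < y => [H nxy|_].
  have [xy|yx|E] := ltgtP x y; first exact: H.
    by have := H y x yx; rewrite eq_sym => /(_ nxy)[]; [right|left].
  by rewrite E eqxx in nxy.
have [le|] := pselect (forall k, jump f k y -> jump f k x); first by left; right.
by move/existsNP => [k /not_implyP jk]; right; left; exists k.
Qed.

Lemma jumpS f k l x : (k <= l)%N -> jump f k x -> jump f l x.
Proof.
move=> kl [x01 H]; split=> // n; have [r [r01 rx far]] := H n.
exists r; split=> //; apply: le_lt_trans far.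
by rewrite lef_pV2 ?posrE// ler_weXn2l// ler1n.
Qed.

Lemma discont_discontinuous f x : discont f x -> discontinuous_at f x.
Proof.
move=> [k [x01 H]] /cvgrPdist_lt/(_ (2 ^- k)).
case=> [|e /= e0 He]; first by rewrite invr_gt0 exprn_gt0.
have [n ne] := exists_pow2_lt e0.
have [r [r01 rx far]] := H n.
have := He (ratr r); rewrite /= in_itv/= distrC => /(_ (lt_trans rx ne) r01).
by rewrite distrC; apply/negP; rewrite -leNgt ltW.
Qed.

Section Bounded_variation.
Variable f : R -> R.
Hypothesis bv : bounded_variation 0 1 f.

Let V x := fine (total_variation 0 x f).

Lemma total_variation_fin x y : 0 <= x -> x <= y -> y <= 1 ->
  total_variation x y f \is a fin_num.
Proof.
move=> x0 xy y1; apply/(bounded_variationP _ xy).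
apply: (bounded_variationl (b := 1)) => //.
by apply: (bounded_variationr (a := 0)) => //; exact: le_trans y1.
Qed.

Lemma fine_total_variationD x y z : 0 <= x -> x <= y -> y <= z -> z <= 1 ->
  fine (total_variation x z f) =
  fine (total_variation x y f) + fine (total_variation y z f).
Proof.
move=> x0 xy yz z1; rewrite (total_variationD f xy yz) fineD//.
  by apply: total_variation_fin => //; exact: le_trans z1.
by apply: total_variation_fin => //; exact: le_trans xy.
Qed.

Lemma dist_le_total_variation x y z w : 0 <= x -> x <= y -> y <= z -> z <= w ->
  w <= 1 -> `|f z - f y| <= fine (total_variation x w f).
Proof.
move=> x0 xy yz zw w1.
have F a b : x <= a -> a <= b -> b <= w -> total_variation a b f \is a fin_num.
  move=> xa ab bw; apply: total_variation_fin => //; first exact: le_trans xa.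
  exact: le_trans w1.
have y0 := le_trans x0 xy; have z1 := le_trans zw w1.
have xz := le_trans xy yz.
have P a b : x <= a -> a <= b -> b <= w -> 0 <= fine (total_variation a b f).
  by move=> xa ab bw; rewrite fine_ge0// total_variation_ge0.
rewrite (fine_total_variationD x0 xz zw w1).
rewrite (fine_total_variationD x0 xy yz z1).
have : `|f z - f y| <= fine (total_variation y z f).
  by rewrite -lee_fin fineK ?total_variation_ge// F.
have := P _ _ (lexx x) xy (le_trans yz zw); have := P _ _ xz zw (lexx w).
by lra.
Qed.

(** The rational that witnesses the jump can be taken between [x] and [z], where it contributes to
    the variation. *)
Lemma jump_total_variation k x y z : 0 <= x -> x < y -> y < z -> z <= 1 ->
  jump f k y -> 2 ^- k <= fine (total_variation x z f).
Proof.
move=> x0 xy yz z1 [y01 H].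
have /exists_pow2_lt[n] : 0 < Num.min (y - x) (z - y).
  by rewrite lt_min !subr_gt0 xy.
rewrite lt_min => /andP[nx nz].
have [r [r01 ry /ltW far]] := H n; apply: le_trans far _.
move: ry; rewrite ltr_norml => /andP[h1 h2].
have [yr|ry] := leP y (ratr r).
  by apply: dist_le_total_variation => //; lra.
by rewrite distrC; apply: dist_le_total_variation => //; lra.
Qed.

(* Below a point of level k, the points of level k are well-ordered because the
   total variation grows by 2^-k across each of them. *)
Lemma prec_acc x : discont f x -> Acc (prec f) x.
Proof.
move=> [k]; elim/ltn_ind: k x => k IHk x jx.
have [n xn] : exists n : nat, V x < n%:R * 2 ^- k.
  exists (Num.bound (V x * 2 ^+ k)).
  rewrite ltr_pdivlMr ?exprn_gt0//; apply: archi_boundP.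
  have [/andP[x0 x1] _] := jx.
  by rewrite mulr_ge0// fine_ge0// total_variation_ge0.
elim: n x jx xn => [|n IHn] x jx xn.
  have [/andP[x0 x1] _] := jx; move: xn; rewrite mul0r ltNge.
  by rewrite fine_ge0// total_variation_ge0.
have lower y z : jump f k y -> prec f z y -> Acc (prec f) z \/ jump f k z /\ z < y.
  move=> jy [[j [jz njy]]|[le zy]]; last by right; split=> //; exact: le.
  left; apply: IHk jz; rewrite ltnNge; apply/negP => kj; apply: njy.
  exact: jumpS jy.
apply: Acc_intro => y /(lower _ _ jx)[//|[jy yx]].
(* Two steps down are needed: the jump at [y] is charged to the variation between [z] and [x], which
   have [y] strictly between them. *)
apply: Acc_intro => z /(lower _ _ jy)[//|[jz zy]].
apply: IHn => //.
have [/andP[x0 x1] _] := jx; have [/andP[z0 z1] _] := jz.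
have := jump_total_variation z0 zy yx x1 jy.
have := fine_total_variationD (lexx 0) z0 (ltW (lt_trans zy yx)) x1.
rewrite -!/(V _); move: xn; rewrite -natr1 mulrDl mul1r.
lra.
Qed.
End Bounded_variation.
End Precedence.

(** * The Banach-Zarecki theorem *)

Section BanachZarecki.
Context {R : realType}.
Implicit Types (f : R -> R) (x y z : R).
Local Notation mu := (@lebesgue_measure R).

Lemma near_all_seq (T : eqType) (s : seq T) (P : T -> nat -> Prop) :
  (forall x : T, x \in s -> \forall n \near \oo, P x n) ->
  \forall n \near \oo, forall x : T, x \in s -> P x n.
Proof.
elim: s => [_|a s IH H]; first exact: nearW.
have Ha : \forall n \near \oo, P a n by apply: H; rewrite mem_head.
have Hs : \forall n \near \oo, forall x : T, x \in s -> P x n.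
  by apply: IH => x xs; apply: H; rewrite inE xs orbT.
near=> n => x; rewrite inE => /predU1P[->|]; last by move: x; near: n.
by near: n.
Unshelve. all: by end_near. Qed.

Definition hits n (K : 'I_n -> set R) y := #|[pred i | y \in K i]|.

Definition ehits n (K : 'I_n -> set R) y : \bar R := ((hits K y)%:R)%:E.

Section Hits.
Variables (n : nat) (K : 'I_n -> set R).

Lemma hitsE y : ehits K y = (\sum_(i < n) (\1_(K i) y)%:E)%E.
Proof.
rewrite sumEFin; congr EFin; rewrite /hits -sum1_card natr_sum big_mkcond/=.
by apply: eq_bigr => i _; rewrite indicE inE; case: (y \in K i).
Qed.

Hypothesis mK : forall i, measurable (K i).

Lemma measurable_hits : measurable_fun [set: R] (ehits K).
Proof.
rewrite (funext hitsE).
by apply: emeasurable_sum => i; exact/measurable_EFinP/measurable_indic.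
Qed.

Lemma integral_hits :
  (\int[mu]_y ehits K y = \sum_(i < n) mu (K i))%E.
Proof.
under eq_integral do rewrite hitsE.
rewrite ge0_integral_sum//.
- by apply: eq_bigr => i _; rewrite integral_indic ?setIT//; exact: mK.
- by move=> i; apply/measurable_EFinP/measurable_indic; exact: mK.
Qed.

Lemma hits_ge (T : eqType) (s : seq T) (j : T -> 'I_n) y :
  uniq s -> {in s &, injective j} -> (forall t, t \in s -> y \in K (j t)) ->
  (size s <= hits K y)%N.
Proof.
move=> us js yK; rewrite -(size_map j) /hits cardE.
apply: uniq_leq_size; first by rewrite map_inj_in_uniq.
by move=> _ /mapP[t ts ->]; rewrite mem_enum; exact: yK.
Qed.
End Hits.

Section Variation.
Variable f : R -> R.
Hypothesis bv : bounded_variation 0 1 f.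
Let V a b := fine (total_variation a b f).

Let node m j : R := j%:R / m.+1%:R.

(* The image of the j-th interval of the subdivision lies in [piece m j]. *)
Let piece m (j : 'I_m.+1) : set R :=
  `[f (node m j) - V (node m j) (node m j.+1),
    f (node m j) + V (node m j) (node m j.+1)]%classic.

Lemma node_bounds m j : (j <= m.+1)%N -> 0 <= node m j <= 1.
Proof.
move=> jm; rewrite divr_ge0//= ler_pdivrMr ?ltr0n// mul1r ler_nat; exact: jm.
Qed.

Lemma node_le m i j : (i <= j)%N -> node m i <= node m j.
Proof. by move=> ij; rewrite ler_pM2r ?invr_gt0 ?ltr0n// ler_nat. Qed.

Lemma sum_variation m : \sum_(j < m.+1) V (node m j) (node m j.+1) = V 0 1.
Proof.
suff H k : (k <= m.+1)%N ->
    \sum_(j < k) V (node m j) (node m j.+1) = V 0 (node m k).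
  by rewrite H// /node divff.
elim: k => [|k IH] km.
  by rewrite big_ord0 /node mul0r /V total_variationxx.
rewrite big_ord_recr/= IH 1?ltnW//; symmetry.
have /andP[? ?] := node_bounds (ltnW km); have /andP[? ?] := node_bounds km.
by rewrite -fine_total_variationD//; exact: node_le.
Qed.

Lemma variation_ge0 m j : 0 <= V (node m j) (node m j.+1).
Proof. by rewrite fine_ge0// total_variation_ge0// node_le. Qed.

Lemma integral_hits_piece m :
  (\int[mu]_y ehits (@piece m) y = (2 * V 0 1)%:E)%E.
Proof.
rewrite integral_hits => [|j]; last exact: measurable_itv.
rewrite -(sum_variation m) mulr_sumr -sumEFin; apply: eq_bigr => j _.
have v0 := variation_ge0 m j.
rewrite lebesgue_measure_itv/= lte_fin; case: ifPn => [_|].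
  by rewrite -EFinB; congr EFin; lra.
by rewrite -leNgt => h; congr EFin; lra.
Qed.

(** An integrable majorant of the Banach indicatrix, which counts the solutions of [f x = y]. The
    lower limit is what Fatou's lemma bounds, as the integrals of the hits do not depend on [m]. *)
Definition multiplicity y : \bar R :=
  limn_einf (fun m => ehits (@piece m) y).

Lemma integrable_multiplicity : mu.-integrable setT multiplicity.
Proof.
have mh m : measurable_fun setT (ehits (@piece m)).
  by apply: measurable_hits => j; exact: measurable_itv.
have h0 m y : (0 <= ehits (@piece m) y)%E by rewrite lee_fin.
have H0 y : (0 <= multiplicity y)%E.
  rewrite /multiplicity limn_einf_lim; apply: lime_ge; first exact: is_cvg_einfs.
  by apply: nearW => m; apply: le_ereal_inf_tmp => _ [k _ <-]; rewrite lee_fin.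
apply/integrableP; split.
  rewrite /multiplicity /limn_einf; apply: measurableT_comp => //.
  by apply: measurable_fun_limn_esup => m; apply: (measurableT_comp _ (mh m)).
under eq_integral do rewrite gee0_abs//.
apply: (@le_lt_trans _ _ (2 * V 0 1)%:E); last exact: ltry.
have := fatou mu measurableT mh (fun m y _ => h0 m y).
under [X in limn_einf X]eq_fun do rewrite integral_hits_piece.
rewrite is_cvg_limn_einfE; last exact: is_cvg_cst.
by rewrite lim_cst.
Qed.

(** Once the mesh is below the distances between the points of [s], these lie in different intervals
    of the subdivision, and [y] lies in the piece of each of them. *)
Lemma multiplicity_ge (s : seq R) y : uniq s ->
  (forall t, t \in s -> 0 <= t <= 1 /\ f t = y) ->
  (((size s)%:R)%:E <= multiplicity y)%E.
Proof.
move=> us sy.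
have sep : \forall m \near \oo, forall t, t \in s -> forall t', t' \in s ->
    t != t' -> m.+1%:R^-1 < `|t - t'|.
  apply: near_all_seq => t _; apply: near_all_seq => t' _.
  have [<-|tt'] := eqVneq t t'; first exact: nearW.
  have tt0 : 0 < `|t - t'| by rewrite normr_gt0 subr_eq0.
  by apply: filterS (near_infty_natSinv_lt (PosNum tt0)) => m /=.
have : \forall m \near \oo, (((size s)%:R)%:E <= ehits (@piece m) y)%E.
  near=> m; rewrite lee_fin ler_nat.
  have m0 : 0 < m.+1%:R :> R by rewrite ltr0n.
  (* The minimum puts [t = 1] into the last interval. *)
  pose j (t : R) : 'I_m.+1 := inord (minn m (Num.truncn (t * m.+1%:R))).
  have jP t : t \in s -> node m (j t) <= t <= node m (j t).+1.
    move=> /sy[/andP[t0 t1] _].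
    have /truncn_itv/andP[lo hi] : 0 <= t * m.+1%:R by rewrite mulr_ge0.
    rewrite /node ler_pdivrMr// ler_pdivlMr// inordK ?ltnS ?geq_minl//.
    case: leqP => h; last by rewrite lo ltW.
    apply/andP; split; first by rewrite (le_trans _ lo)// ler_nat.
    by rewrite ler_piMl.
  apply: (@hits_ge _ _ _ s j) => //.
    move=> t t' ts t's jtt'; apply/eqP/negPn/negP => tt'.
    have : m.+1%:R^-1 < `|t - t'|.
      by move: t ts t' t's tt' {jtt'}; near: m.
    apply/negP; rewrite -leNgt.
    have /andP[h1 h2] := jP _ ts; have := jP _ t's; rewrite -jtt' => /andP[h3 h4].
    have E : node m (j t).+1 = node m (j t) + m.+1%:R^-1.
      by rewrite /node -natr1 mulrDl mul1r.
    move: h2 h4 h1 h3; rewrite E; move: (m.+1%:R^-1) (node m (j t)) => c d h2 h4 h1 h3.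
    by rewrite ler_norml; apply/andP; split; lra.
  move=> t ts; have [/andP[t0 t1] <-] := sy t ts; rewrite inE /piece /= in_itv/=.
  have /andP[h1 h2] := jP _ ts.
  have /andP[n0 _] := node_bounds (ltnW (ltn_ord (j t))).
  have /andP[_ n1] := node_bounds (ltn_ord (j t)).
  by have := dist_le_total_variation bv n0 (lexx _) h1 h2 n1;
    rewrite ler_norml -/(V _ _) => /andP[? ?]; apply/andP; split; lra.
case=> m _ Hm; rewrite /multiplicity limn_einf_lim.
apply: lime_ge; first exact: is_cvg_einfs.
exists m => // k /= mk; apply: le_ereal_inf_tmp => _ [l /= kl <-].
exact/Hm/(leq_trans mk).
Unshelve. all: by end_near. Qed.
End Variation.

(** As [v] lies strictly between the values at the endpoints, the preimage is interior; preimages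
    from disjoint open intervals are then distinct. *)
Lemma continuous_preimage f (a b v : R) : {within `[0, 1]%classic, continuous f} ->
  0 <= a -> a < b -> b <= 1 ->
  `]Num.min (f a) (f b), Num.max (f a) (f b)[%classic v ->
  exists t, [/\ a < t, t < b & f t = v].
Proof.
move=> cf a0 ab b1 /=; rewrite in_itv/= => /andP[lo hi].
have cf' : {within `[a, b], continuous f}.
  apply: continuous_subspaceW cf => t /=; rewrite !in_itv/= => /andP[at_ tb].
  by rewrite (le_trans a0)// (le_trans tb).
have [|t] := @IVT R f a b v (ltW ab) cf'; first by rewrite !ltW.
rewrite in_itv/= => /andP[]; rewrite le_eqVlt => /predU1P[<-|at_].
  by move=> _ E; move: lo hi; rewrite -E; rewrite gt_min ltxx/= lt_max ltxx/=; lra.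
rewrite le_eqVlt => /predU1P[->|tb] E; last by exists t.
by move: lo hi; rewrite -E; rewrite gt_min ltxx orbF lt_max ltxx orbF; lra.
Qed.

(* Banach-Zarecki: if the increments over families of intervals of total length
   2^-N stay large, then the number of intervals of the N-th family whose image
   contains y has large integral although it is dominated by the multiplicity of
   y and vanishes eventually, unless y is in the image of the null set of points
   that lie in infinitely many families. *)
Theorem continuous_bv_lusinN_AC f : {within `[0, 1]%classic, continuous f} ->
  bounded_variation 0 1 f -> lusinN f -> Defs.AC f.
Proof.
move=> cf bv lN; apply: contrapT => /existsNP[k /forallNP Hk].
pose fam := {n : nat & (('I_n -> R) * ('I_n -> R))%type}.
pose lo (F : fam) := (projT2 F).1; pose hi (F : fam) := (projT2 F).2.
pose I (F : fam) i : set R := `]lo F i, hi F i[%classic.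
have /choice[F HF] N : exists F : fam,
    [/\ forall i, [/\ 0 <= lo F i, lo F i < hi F i & hi F i <= 1],
        trivIset setT (I F),
        \sum_(i < projT1 F) (hi F i - lo F i) < 2%:R ^- N &
        2%:R ^- k <= \sum_(i < projT1 F) `|f (hi F i) - f (lo F i)|].
  have /existsNP[n /existsNP[x /existsNP[y]]] := Hk N.
  move=> /not_implyP[b /not_implyP[t /not_implyP[l /negP]]]; rewrite -leNgt => h.
  by exists (existT _ n (x, y)).
pose J N i : set R := `]Num.min (f (lo (F N) i)) (f (hi (F N) i)),
                        Num.max (f (lo (F N) i)) (f (hi (F N) i))[%classic.
have JI N i y : J N i y -> exists2 t, I (F N) i t & f t = y /\ 0 <= t <= 1.
  have [/(_ i)[h0 h h1] _ _ _] := HF N.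
  move/(continuous_preimage cf h0 h h1) => [t [ht th ft]]; exists t.
    by rewrite /I /= in_itv/= ht.
  by rewrite ft (le_trans h0 (ltW ht)) (le_trans (ltW th) h1).
(* The family is extended by empty sets to all natural indices, to use countable unions. *)
pose I' N j : set R := if insub j is Some i then I (F N) i else set0.
have I'E N (i : 'I_(projT1 (F N))) : I' N i = I (F N) i by rewrite /I' valK.
pose A N := \big[setU/set0]_(j < projT1 (F N)) I' N j.
have AP N i t : I (F N) i t -> A N t.
  by move=> It; rewrite /A -bigcup_mkord; exists i => /=; rewrite ?I'E.
have mI' N j : measurable (I' N j).
  by rewrite /I'; case: insub => [i|]; [exact: measurable_itv|exact: measurable0].
have mA N : measurable (A N) by apply: bigsetU_measurable => j _; exact: mI'.
have muA N : (mu (A N) <= (2 ^- N)%:E)%E.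
  apply: (le_trans (@Boole_inequality _ _ _ mu (I' N) _ (fun j _ => mI' N j))).
  have [H _ /ltW l _] := HF N; apply: (@le_trans _ _
    (\sum_(i < projT1 (F N)) (hi (F N) i - lo (F N) i))%:E); last by rewrite lee_fin.
  rewrite -sumEFin; apply: lee_sum => i _; have [_ lh _] := H i.
  rewrite I'E /I; have := @lebesgue_measure_itv R `]lo (F N) i, hi (F N) i[.
  by rewrite /= lte_fin lh -EFinB => <-; exact: lexx.
pose E := lim_sup_set A.
have E01 : E `<=` `[0, 1]%classic.
  move=> t /(_ 0%N Logic.I) [N _]; rewrite /A -bigcup_mkord => -[j /= jn].
  rewrite /I'; case: insubP => [i _ _|]; last by rewrite jn.
  have [/(_ i)[h0 h h1] _ _ _] := HF N; rewrite /I /= !in_itv/= => /andP[ht th].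
  by rewrite (le_trans h0 (ltW ht)) (le_trans (ltW th) h1).
have mE : measurable E.
  by apply: bigcap_measurable => // n _; apply: bigcup_measurable => j _; exact: mA.
(* Borel-Cantelli: the bounds [2 ^- N] are summable, and [2 / 2 ^ n.+1] is the form in which
   [epsilon_trick0] sums them. *)
have E0 : mu E = 0%E.
  apply: lim_sup_set_cvg0 => //.
  apply: (@le_lt_trans _ _ (\sum_(n <oo) (2 / (2 ^ n.+1)%:R : R)%:E)%E).
    apply: lee_nneseries => // n _; rewrite (le_trans (muA n))// lee_fin.
    by rewrite natrX exprS invfM mulrA divff// mul1r.
  by rewrite (le_lt_trans (epsilon_trick0 _ _))// ltry.
have nE : mu.-negligible (f @` E) by apply: lN => //; exists E; split.
have mJ N i : measurable (J N i) by exact: measurable_itv.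
have HJ N : ((2 ^- k)%:E <= \int[mu]_y ehits (J N) y)%E.
  have [_ _ _ h] := HF N; rewrite integral_hits//.
  apply: (@le_trans _ _ (\sum_(i < projT1 (F N))
    `|f (hi (F N) i) - f (lo (F N) i)|)%:E).
    by rewrite lee_fin.
  rewrite -sumEFin; apply: lee_sum => i _.
  rewrite /J lebesgue_measure_itv/= lte_fin.
  move: (f _) (f _) => a b; case: ltP => ab.
    rewrite -EFinB lee_fin; case: (leP b a) ab => [ba _|ab _].
      by rewrite ler0_norm ?subr_le0// opprB.
    by rewrite ger0_norm ?subr_ge0// ltW.
  rewrite lee_fin; move: ab; case: (leP b a) => ab ba.
    by rewrite (@le_anti _ _ a b) ?subrr ?normr0 ?ba.
  by move: (lt_le_trans ab ba); rewrite ltxx.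
(* One preimage of [y] is chosen in each interval that is hit; the intervals are disjoint, so
   [multiplicity] counts all of these preimages. *)
have dom N y : (`|ehits (J N) y| <= multiplicity f y)%E.
  have [H tI _ _] := HF N.
  rewrite gee0_abs; last by rewrite lee_fin.
  have Jt (i : 'I_(projT1 (F N))) : exists t,
      J N i y -> I (F N) i t /\ f t = y /\ 0 <= t <= 1.
    have [/JI[t It ft]|nJ] := pselect (J N i y); first by exists t.
    by exists 0.
  have [t Ht] := choice Jt.
  pose s := [seq t i | i <- enum [pred i | y \in J N i]].
  have -> : ehits (J N) y = ((size s)%:R)%:E.
    by rewrite size_map /ehits /hits cardE.
  apply: multiplicity_ge => //.
    rewrite map_inj_in_uniq ?enum_uniq// => i j.
    rewrite !mem_enum !inE => /Ht[Ii _] /Ht[Ij _] tij.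
    apply: tI => //; by exists (t i); split => //; rewrite tij.
  by move=> _ /mapP[i + ->]; rewrite mem_enum inE => /Ht[_ []].
(* A finite multiplicity leaves finitely many preimages of [y]. Each is outside [E], hence in none
   of the [A N] from some [N] on, whereas a hit would put one of them into [A N]. *)
have ev y : multiplicity f y \is a fin_num -> ~ (f @` E) y ->
    \forall N \near \oo, ehits (J N) y = 0%E.
  move=> fy nEy; pose T : set R := [set t | 0 <= t <= 1 /\ f t = y].
  have /finite_seqP[s Ts] : finite_set T.
    apply: contrapT => /(infinite_set_fset (Num.truncn (fine (multiplicity f y))).+1).
    move=> [B BT cB].
    have := @multiplicity_ge f bv _ y (finmap.fset_uniq B) BT.
    rewrite -(fineK fy) lee_fin => h.
    have := truncnS_gt (fine (multiplicity f y)); apply/negP; rewrite -leNgt.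
    by rewrite (le_trans _ h)// ler_nat.
  have : \forall N \near \oo, forall t, t \in s -> ~ A N t.
    apply: near_all_seq => t ts.
    have Tt : T t by rewrite Ts.
    have /existsNP[n /not_implyP[_ nt]] : ~ E t.
      by move=> Et; apply: nEy; exists t => //; case: Tt.
    exists n => // m /= nm Amt; apply: nt; exists m => //.
  apply: filterS => N nA; rewrite /ehits (_ : hits _ _ = 0%N)//; apply: eq_card0 => i.
  apply/negbTE/negP; rewrite inE => /JI[t It [ft t01]].
  apply: (nA t); last exact: AP It.
  by have : T t by []; rewrite Ts.
have aeJ : {ae mu, forall y, setT y -> (ehits (J N) y @[N --> \oo] --> 0%E)}.
  have ae1 := integrable_ae measurableT (integrable_multiplicity bv).
  have ae2 : {ae mu, forall y, ~ (f @` E) y}.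
    by apply: negligibleS nE => y /= /contrapT.
  apply: filterS2 ae1 ae2 => y /(_ Logic.I) fy nEy _.
  by apply: cvg_near_cst; exact: ev.
have aeB : {ae mu, forall y N, setT y -> (`|ehits (J N) y| <= multiplicity f y)%E}.
  by apply: aeW => y N _; exact: dom.
have [_ _] := @dominated_convergence _ _ _ mu _ measurableT _ (cst 0%E)
  (multiplicity f) (fun N => measurable_hits (mJ N)) (measurable_cst 0%E) aeJ
  (integrable_multiplicity bv) aeB.
rewrite integral_cst// mul0e => c0.
have : ((2 ^- k)%:E <= 0%E :> \bar R)%E.
  by rewrite -(cvg_lim _ c0)//; apply: lime_ge; [exact: cvgP c0|exact: nearW].
by rewrite lee_fin; apply/negP; rewrite -ltNge invr_gt0 exprn_gt0.
Qed.
End BanachZarecki.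

(** * Continuity from the absence of jumps *)

Section NoJump.
Context {R : realType}.
Variable f : R -> R.

(** For [t] near [x], the values are compared through a rational [r] near both: no jump at [x]
    bounds [f r - f x] and no jump at [t] bounds [f r - f t]. *)
Lemma no_discont_continuous : (forall x, ~ discont f x) ->
  {within `[0, 1]%classic, continuous f}.
Proof.
move=> nd.
have near k x : 0 <= x <= 1 -> exists n, forall r : rat, 0 <= (ratr r : R) <= 1 ->
    `|ratr r - x| < 2 ^- n -> `|f (ratr r) - f x| <= 2 ^- k.
  move=> x01; have /forallNP/(_ k) nj := nd x; apply: contrapT => /forallNP H.
  apply: nj; split=> // n.
  have /existsNP[r /not_implyP[r01 /not_implyP[rx /negP]]] := H n.
  by rewrite -ltNge => far; exists r.
apply/subspace_continuousP => x; rewrite /= in_itv/= => x01.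
apply/cvgrPdist_lt => e e0.
have /exists_pow2_lt[k ke] : 0 < e / 2 by rewrite divr_gt0.
have [n Hn] := near k x x01.
exists (2 ^- n) => /=; first by rewrite invr_gt0 exprn_gt0.
move=> t /= xt; rewrite in_itv/= => t01.
have [n' Hn'] := near k t t01.
(* Within [d] of [t], a rational is close enough to [t] and still within [2 ^- n] of [x]. *)
pose d := Num.min (2 ^- n') (2 ^- n - `|x - t|).
have d0 : 0 < d by rewrite lt_min invr_gt0 exprn_gt0//= subr_gt0.
have /rat_in_itvoo[r] : Num.max 0 (t - d) < Num.min 1 (t + d).
  case/andP: t01 => t0 t1.
  by rewrite lt_min !gt_max ltr01/=; apply/and3P; split; lra.
rewrite in_itv/= gt_max lt_min => /andP[/andP[r0 rt] /andP[r1 tr]].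
have r01 : 0 <= (ratr r : R) <= 1 by rewrite !ltW.
have : `|ratr r - t| < d by rewrite ltr_norml; apply/andP; split; lra.
rewrite lt_min => /andP[rn' rn].
have rx : `|ratr r - x| < 2 ^- n.
  rewrite -(subrKA t) (le_lt_trans (ler_normD _ _))// distrC (distrC t x).
  rewrite addrC -ltrBrDl.
  by rewrite distrC.
have := Hn r r01 rx; have := Hn' r r01 rn'.
rewrite !ler_norml ltr_norml /from_subspace => /andP[? ?] /andP[? ?].
by apply/andP; split; lra.
Qed.

Lemma not_AC_discont :
  bounded_variation 0 1 f -> lusinN f -> ~ Defs.AC f -> exists x, discont f x.
Proof.
move=> bv lN nAC; apply: contrapT => /forallNP nd; apply: nAC.
exact: continuous_bv_lusinN_AC (no_discont_continuous nd) bv lN.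
Qed.
End NoJump.

(** * Finding a point of discontinuity from Omega *)

(** This quantifier ranges over sequences and is out of reach of [existsE2]; deciding it is what
    Omega is for. *)
Definition code_pred F al := exists be, code_discont F be /\ code_prec F be al.

Definition seq_elt (be : functional baire) i : functional baire :=
  fun n => be (CodeSeq.code [:: i; n]).+1.

Lemma fun_seq_elt A (G : env A) (D : A -> Prop) be i : Fun G D be -> Comp G D i ->
  Fun G D (fun a => seq_elt (be a) (i a)).
Proof.
move=> /(fun_wk Nat) cbe /(comp_wk Nat) ci.
by apply: (comp_at cbe); apply/comp_succ/comp_code2 => //; cvar.
Qed.

Section Minimal.
Context {R : realType}.
Implicit Types (f : R -> R) (x y : R) (al be : functional baire).

Lemma exists_code x : exists al, codes_real al x.
Proof.
have H n : exists r, `|ratr (q r) - x| <= 2 ^- n.+2.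
  have /exists_rat_code[r [xr rx]] : x < x + 2 ^- n.+2 by rewrite ltrDl.
  by exists r; rewrite ger0_norm; lra.
have [al Hal] := choice H.
by exists al; exact: codes_real_approx.
Qed.

Lemma discont_01 f x : discont f x -> 0 <= x <= 1.
Proof. by case=> k []. Qed.

Lemma prec_discont f x y : prec f x y -> discont f y -> discont f x.
Proof. by case=> [[k []]|[H _] [k /H]]; exists k. Qed.

Lemma prec_minimal f x : bounded_variation 0 1 f -> discont f x ->
  exists2 y, discont f y & forall z, ~ prec f z y.
Proof.
move=> bv dx; move: (prec_acc bv dx) (dx) => {dx}; elim=> {}x _ IH dx.
have [[y yx]|] := pselect (exists y, prec f y x).
  exact/(IH y yx)/(prec_discont yx).
by move/forallNP => nx; exists x.
Qed.

Section Codes.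
Variables (F : functional (baire ~> baire)) (f : R -> R).
Hypothesis Ff : codes_fun F f.

Lemma code_predP al x : codes_real al x -> discont f x ->
  code_pred F al <-> exists y, prec f y x.
Proof.
move=> cx dx; split=> [[be [dbe]]|[y yx]].
  have [y cy] := @fast_cauchy_codes R _ dbe.1.
  move/(code_discontP Ff cy) : dbe => dy.
  by move/(code_precP Ff (discont_01 dy) (discont_01 dx) cy cx); exists y.
have dy := prec_discont yx dx; have [be cy] := exists_code y.
exists be; split; first exact/(code_discontP Ff cy).
exact/(code_precP Ff (discont_01 dy) (discont_01 dx) cy cx).
Qed.

Lemma code_discont_real al : code_discont F al ->
  exists2 x, codes_real al x & discont f x.
Proof.
move=> dal; have [x cx] := @fast_cauchy_codes R _ dal.1.
by exists x => //; exact/(code_discontP Ff cx).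
Qed.
End Codes.

Definition codes_bv (F : functional (baire ~> baire)) :=
  exists2 f : R -> R, codes_fun F f & bounded_variation 0 1 f.

Lemma codes_seq_mem be (s : seq R) x : codes_seq be s -> x \in s ->
  exists2 i, (i < be 0)%N & codes_real (seq_elt be i) x.
Proof.
case=> s0 H xs; exists (index x s); first by rewrite s0 index_mem.
by rewrite -[X in codes_real _ X](nth_index 0 xs); apply: H; rewrite index_mem.
Qed.

Section Omega.
Variable Om : pfunctional ((baire ~> Nat) ~> baire).
Hypothesis OmP : is_Omega R Om.

(** Two distinct points are comparable, so at most one lacks a predecessor and Omega is defined on
    the set. In the recursion [Q] selects the predecessors of a given point; in the final search it
    is trivial. [Qext] makes the set independent of the codes. *)
Lemma omega_minimal A (G : env A) D F (Q : A -> functional baire -> Prop) i :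
  (i < esize G)%N -> (forall a, nth (nent 0) (G a) i = pent Om) ->
  (forall a, D a -> codes_bv (F a)) ->
  (forall a al be x, D a -> codes_real al x -> codes_real be x ->
    code_discont (F a) al -> Q a al -> Q a be) ->
  Comp (push G baire) (fun p => D p.1) (fun p => nat_of_bool
    `[< code_discont (F p.1) p.2 /\ Q p.1 p.2 /\ ~ code_pred (F p.1) p.2 >]) ->
  exists2 be : A -> functional baire, Fun G D be &
    forall a, D a -> exists2 s : seq R, codes_seq (be a) s &
      forall al x, codes_real al x -> code_discont (F a) al -> Q a al ->
        ~ code_pred (F a) al -> x \in s.
Proof.
move=> iG Gi DF Qext cc.
pose S a al := code_discont (F a) al /\ Q a al /\ ~ code_pred (F a) al.
pose c a : functional (baire ~> Nat) := fun al => nat_of_bool `[< S a al >].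
pose X a : set R := [set x | exists2 al, codes_real al x & S a al].
have Xc a : D a -> codes_set (c a) (X a) /\ is_subset1 (X a).
  move=> Da; have [f Ff bv] := DF a Da; split; first split.
  - move=> x [al cx [/(code_discontP Ff cx)/discont_01 + _]] /=.
    by rewrite in_itv.
  - move=> x al x01 cx; rewrite /c; congr nat_of_bool; apply/idP/idP.
      by move/asboolP => Sal; rewrite inE; exists al.
    rewrite inE => -[be cbe [dbe [Qbe nbe]]]; apply/asboolP; split.
      by apply/(code_discontP Ff cx); apply/(code_discontP Ff cbe).
    split; first exact: Qext Da cbe cx dbe Qbe.
    move/(code_discontP Ff cbe): dbe => dx.
    by move/(code_predP Ff cx dx)/(code_predP Ff cbe dx).
  - move=> x y [al cx [/(code_discontP Ff cx) dx [_ nx]]].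
    move=> [be cy [/(code_discontP Ff cy) dy [_ ny]]].
    apply/eqP; apply: contrapT => /negP/(prec_total f)[xy|yx].
      by apply: ny; apply/(code_predP Ff cy dy); exists x.
    by apply: nx; apply/(code_predP Ff cx dx); exists y.
have H a : D a -> exists be : functional baire, exists s : seq R,
    [/\ forall n, Om (c a) n = Some (be n), codes_seq be s &
        forall x, X a x -> x \in s].
  by move=> /Xc[]; exact: (OmP (c a)).1.
pose be a n := odflt 0%N (Om (c a) n).
exists be => [|a Da].
  rewrite /Fun; apply: (comp_applyO (i := i.+1) (Om := Om)
    (c := fun p => c p.1.1 p.2) (n := fun p => p.2)) => //.
  - by move=> [a n] _; exact: Gi.
  - exact: (comp_wk2 Nat cc).
  - by cvar.
  - by move=> [a n] /= Da; have [b [s [/(_ n) + _ _]]] := H a Da; rewrite /be => ->.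
have [b [s [Hb cb Xs]]] := H a Da.
have -> : be a = b by apply/funext => n; rewrite /be Hb.
by exists s => // al x cx dx Qx nx; apply: Xs; exists al.
Qed.

Definition oracle_env : env (functional (baire ~> baire)).
Proof. by exists (fun F => [:: tent F; pent Om; tent existsE2]) 3%N 2%N. Defined.

Let G2 := push (push oracle_env baire) Nat.

(** The last clause is the induction hypothesis: the index [p.2], applied to itself, is correct at
    all predecessors of the current point. *)
Let D2 (p : functional (baire ~> baire) * functional baire * nat) :=
  [/\ codes_bv p.1.1, code_discont p.1.1 p.1.2 &
    forall be, code_discont p.1.1 be -> code_prec p.1.1 be p.1.2 ->
      keval p.2 (nent p.2 :: tent be :: oracle_env p.1.1)
        (nat_of_bool `[< code_pred p.1.1 be >])].

(* The recursive call is made through the index p.2 found among the arguments, on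
   predecessors only, which is why the values of Omega used here exist. *)
Lemma comp_pred_step : Comp G2 D2 (fun p => nat_of_bool `[< code_pred p.1.1 p.1.2 >]).
Proof.
pose Q (p : functional (baire ~> baire) * functional baire * nat) al :=
  code_prec p.1.1 al p.1.2.
have vF : Var G2 D2 (fun p => p.1.1) by exists 2%N.
have val : Fun G2 D2 (fun p => p.1.2) by apply: fun_var; exists 1%N.
have Qext a b b' x : D2 a -> codes_real b x -> codes_real b' x ->
    code_discont a.1.1 b -> Q a b -> Q a b'.
  case: a => -[F al] m [[f Ff bv] dal _] cx cx' db; rewrite /Q/=.
  have [y cy dy] := code_discont_real Ff dal.
  move/(code_discontP Ff cx): db => /discont_01 x01.
  move/(code_precP Ff x01 (discont_01 dy) cx cy) => xy.
  exact/(code_precP Ff x01 (discont_01 dy) cx' cy).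
have bvF a : D2 a -> codes_bv a.1.1 by case.
have [|be cbe H] := omega_minimal (G := G2) (i := 3%N) isT (fun=> erefl) bvF Qext.
  have cg : Dec (push G2 baire) (fun p => D2 p.1)
     (fun p => code_discont p.1.1.1 p.2 /\ code_prec p.1.1.1 p.2 p.1.1.2).
    have vF' := var_wk baire vF; have va := fun_wk baire val.
    have vb : Fun (push G2 baire) (fun p => D2 p.1) (fun p => p.2).
      exact/fun_var/var_top.
    by apply: dec_and; [exact: dec_discont|exact: dec_prec].
  apply: (comp_ext _ (comp_if (h := fun=> 0%N)
    (g := fun p => nat_of_bool `[< ~ code_pred p.1.1.1 p.2 >]) cg _ _)).
  - move=> p _; case: ifPn => [/asboolP[d Qp]|/asboolP n].
      congr nat_of_bool; apply: asbool_equiv_eq; split; first by [].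
      by case=> _ [].
    by apply/esym; case: asboolP => // -[d [Qp _]]; case: n.
  - apply: (@dec_not _ (push G2 baire) _ (fun p => code_pred p.1.1.1 p.2)).
    (* The index stays in front, and the new point at position 0 replaces the old one at position
       2. *)
    apply: (@comp_call _ _ _ [:: 1; 0; 3; 4; 5]%N (fun p => p.1.2)) => //.
      by cvar.
    move=> [[[F al] m] b] [[_ _ IH] /asboolP[/= d Qb]].
    exact: IH.
  - exact: comp_const.
(* If there is a predecessor, then the minimal point is one and is listed, so it suffices to search
   the list. Other listed reals do no harm, as each is tested. *)
pose P p := exists i, (i < be p 0)%N /\ code_discont p.1.1 (seq_elt (be p) i) /\
  code_prec p.1.1 (seq_elt (be p) i) p.1.2.
suff : Dec G2 D2 P.
  apply: dec_ext => -[[F al] m] Dp; have [[f Ff bv] dal _] := Dp.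
  split=> [[i [_ ?]]|]; first by exists (seq_elt (be (F, al, m)) i).
  have [x cx dx] := code_discont_real Ff dal.
  move=> /(code_predP Ff cx dx) px.
  have [y dy ny] := prec_minimal bv dx.
  have xy : prec f y x.
    have /(prec_total f)[//|/ny//] : y != x.
    by apply/eqP => yx; case: px => z; rewrite -yx => /ny.
  have [s cs Hs] := H _ Dp.
  have [bt cy] := exists_code y.
  have : y \in s.
    apply: (Hs _ _ cy) => /=.
    - exact/(code_discontP Ff cy).
    - exact/(code_precP Ff (discont_01 dy) (discont_01 dx) cy cx).
    - by move/(code_predP Ff cy dy) => [z /ny].
  move=> /(codes_seq_mem cs)[i i0 ci]; exists i; split=> //=; split.
    exact/(code_discontP Ff ci).
  exact/(code_precP Ff (discont_01 dy) (discont_01 dx) ci cx).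
have cbi : Fun (push G2 Nat) (fun p => D2 p.1) (fun p => seq_elt (be p.1) p.2).
  by apply: fun_seq_elt; [exact: fun_wk|cvar].
apply: dec_exists; apply: dec_and.
  apply: dec_leq; first by apply: comp_succ; cvar.
  by apply: (comp_at (fun_wk Nat cbe)); exact: comp_const.
apply: dec_and; first by apply: dec_discont => //; exact: (var_wk Nat vF).
by apply: dec_prec => //; [exact: (var_wk Nat vF)|exact: (fun_wk Nat val)].
Qed.

(** The recursion is closed by passing [d] to itself; accessibility of [x] makes the nested calls
    terminate. *)
Lemma pred_computable : exists d, forall F al, codes_bv F -> code_discont F al ->
  keval d (nent d :: tent al :: oracle_env F) (nat_of_bool `[< code_pred F al >]).
Proof.
have [d Hd] := comp_pred_step; exists d => F al bvF dal.
have [f Ff bv] := bvF.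
have [x cx dx] := code_discont_real Ff dal.
move: (prec_acc bv dx) al dal cx (dx) => {dx}; elim=> {}x _ IH al dal cx dx.
apply: (Hd (F, al, d)); split=> //= be dbe ba.
have [y cy dy] := code_discont_real Ff dbe.
apply: (IH y) => //.
exact/(code_precP Ff (discont_01 dy) (discont_01 dx) cy cx).
Qed.
End Omega.
End Minimal.

(** Only one real is concerned: all [al] without predecessor code the least point. *)
Definition reaches F r :=
  exists al, code_discont F al /\ ~ code_pred F al /\ ~ code_below al r.

(* The n-th approximation of the least point of discontinuity y for [prec] is the
   largest multiple of 2^-(n+2) that is at most y, and 0 if there is none. *)
Definition search_approx F n := CodeSeq.code
  [:: \sum_(j < 2 ^ n.+2) `[< reaches F (CodeSeq.code [:: j.+1; 0; (2 ^ n.+2).-1]) >];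
      0; (2 ^ n.+2).-1]%N.

(** The values depend on [F] alone, so a single functional is computable in every functional that
    meets the specification of Omega. *)
Definition discont_search (R : realType) : pfunctional ((baire ~> baire) ~> baire) :=
  fun F n => if `[< @codes_bv R F >] then Some (search_approx F n) else None.

Section Search.
Context {R : realType}.
Implicit Types (f : R -> R) (x y : R) (al be : functional baire).

Section Omega.
Variable Om : pfunctional ((baire ~> Nat) ~> baire).
Hypothesis OmP : is_Omega R Om.

Definition search_env : env (functional (baire ~> baire) * functional Nat).
Proof.
by exists (fun p => [:: tent p.1; nent p.2; pent Om; tent existsE2]) 4%N 3%N.
Defined.

Let D (p : functional (baire ~> baire) * functional Nat) := @codes_bv R p.1.

Lemma comp_search_approx :
  Comp search_env D (fun p => search_approx p.1 p.2).
Proof.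
have vF : Var search_env D (fun p => p.1) by exists 0%N.
have [d Hd] := pred_computable OmP.
have [|be cbe H] := @omega_minimal R _ OmP _ search_env D (fun p => p.1)
    (fun _ _ => True) 2%N isT (fun=> erefl) (fun _ => id) (fun _ _ _ _ _ _ _ _ => id).
  apply: (comp_ext _ (comp_if (h := fun=> 0%N)
    (b := fun p => `[< code_discont p.1.1 p.2 >])
    (g := fun p => nat_of_bool `[< ~ code_pred p.1.1 p.2 >]) _ _ _)).
  - move=> p _; case: ifPn => [/asboolP ?|/asboolP n].
      congr nat_of_bool; apply: asbool_equiv_eq; split; first by [].
      by case=> _ [].
    by apply/esym; case: asboolP => // -[].
  - by apply: dec_discont; [exact: (var_wk baire vF)|exact/fun_var/var_top].
  - apply: (@dec_not _ (push search_env baire) _ (fun p => code_pred p.1.1 p.2)).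
    apply: (comp_let (g := fun=> d)
      (h := fun p => nat_of_bool `[< code_pred p.1.1.1 p.1.2 >])).
      exact: comp_const.
    (* The index [d], [al], [F] and the two oracles are kept; the precision at position 3 is
       dropped. *)
    apply: (@comp_call _ _ _ [:: 0; 1; 2; 4; 5]%N (fun=> d)) => //.
      exact: comp_const.
    by move=> [[[F n] al] m] [[DF /asboolP dal] /= ->]; exact: Hd.
  - exact: comp_const.
apply: comp_code3; [|exact: comp_const|]; last first.
  by apply/comp_pred/comp_exp; [exact: comp_const|do 2 apply: comp_succ; cvar].
apply: (comp_sum (b := fun p j =>
  nat_of_bool `[< reaches p.1 (CodeSeq.code [:: j.+1; 0; (2 ^ p.2.+2).-1]%N) >])).
  by apply: comp_exp; [exact: comp_const|do 2 apply: comp_succ; cvar].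
set G1 := push search_env Nat; pose D1 (p : _ * functional Nat) := D p.1.
have cr : Comp G1 D1 (fun p => CodeSeq.code [:: p.2.+1; 0; (2 ^ p.1.2.+2).-1]%N).
  apply: comp_code3; [by apply: comp_succ; cvar|exact: comp_const|].
  by apply/comp_pred/comp_exp; [exact: comp_const|do 2 apply: comp_succ; cvar].
pose elt p i := seq_elt (be p) i.
(* The least point is listed, so minimality among the listed points is minimality among all, and the
   quantifiers become bounded. *)
suff: Dec G1 D1 (fun p => exists i, (i < be p.1 0)%N /\
    code_discont p.1.1 (elt p.1 i) /\
    (forall j, (j < be p.1 0)%N -> code_discont p.1.1 (elt p.1 j) ->
      ~ code_prec p.1.1 (elt p.1 j) (elt p.1 i)) /\
    ~ code_below (elt p.1 i) (CodeSeq.code [:: p.2.+1; 0; (2 ^ p.1.2.+2).-1]%N)).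
  apply: dec_ext => -[[F n] j] DF /=.
  have [f Ff bv] := DF; have [s cs Hs] := H _ DF; move: (CodeSeq.code _) => r.
  split.
    move=> [i [i0 [di [mi bi]]]]; exists (elt (F, n) i); split=> //; split=> //.
    have [x cx dx] := code_discont_real Ff di.
    move/(code_predP Ff cx dx) => px.
    have [y dy ny] := prec_minimal bv dx.
    have xy : prec f y x.
      have /(prec_total f)[//|/ny//] : y != x.
      by apply/eqP => yx; case: px => z; rewrite -yx => /ny.
    have [bt cy] := exists_code y.
    have ys : y \in s.
      apply: (Hs _ _ cy) => //=; first exact/(code_discontP Ff cy).
      by move/(code_predP Ff cy dy) => [z /ny].
    have [k k0 ck] := codes_seq_mem cs ys.
    apply: (mi k k0); first exact/(code_discontP Ff ck).
    exact/(code_precP Ff (discont_01 dy) (discont_01 dx) ck cx).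
  move=> [al [dal [nal bal]]].
  have [x cx dx] := code_discont_real Ff dal.
  have xs : x \in s by exact: (Hs _ _ cx).
  have [i i0 ci] := codes_seq_mem cs xs; exists i; split=> //; split.
    exact/(code_discontP Ff ci).
  split; last by rewrite (code_belowP ci) -(code_belowP cx).
  move=> k k0 dk; have [y cy dy] := code_discont_real Ff dk.
  move=> /(code_precP Ff (discont_01 dy) (discont_01 dx) cy ci) yx.
  by apply: nal; apply/(code_predP Ff cx dx); exists y.
have vF1 := var_wk Nat vF; have cbe1 := fun_wk Nat cbe.
have cb0 : Comp G1 D1 (fun p => be p.1 0%N) by exact/(comp_at cbe1)/comp_const.
have ci : Fun (push G1 Nat) (fun p => D1 p.1) (fun p => elt p.1.1 p.2).
  by apply: fun_seq_elt; [exact: (fun_wk Nat cbe1)|cvar].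
have vF2 := var_wk Nat vF1.
have lt_dec : Dec (push G1 Nat) (fun p => D1 p.1) (fun p => (p.2 < be p.1.1 0)%N).
  by apply: dec_leq; [apply: comp_succ; cvar|exact: (comp_wk Nat cb0)].
apply: dec_exists; apply: dec_and; first exact: lt_dec.
apply: dec_and; first exact: dec_discont.
apply: dec_and; last by apply/dec_not/dec_below => //; exact: (comp_wk Nat cr).
have cj : Fun (push (push G1 Nat) Nat) (fun p => D1 p.1.1) (fun p => elt p.1.1.1 p.2).
  by apply: fun_seq_elt; [exact: (fun_wk Nat (fun_wk Nat cbe1))|cvar].
apply: dec_forall; apply: dec_imply.
  apply: dec_leq; first by apply: comp_succ; cvar.
  exact: (comp_wk Nat (comp_wk Nat cb0)).
apply: dec_imply; first by apply: dec_discont => //; exact: (var_wk Nat vF2).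
apply/dec_not/dec_prec => //; first exact: (var_wk Nat vF2).
exact: (fun_wk Nat ci).
Qed.

Lemma search_computable :
  computable_in (discont_search R) [:: pent Om; tent existsE2].
Proof.
have [e He] := comp_search_approx; exists e => -[F [n []]] a.
rewrite /= /discont_search; case: asboolP => // DF [<-].
exact: (He (F, n)).
Qed.
End Omega.

Lemma search_class : @discontinuity_functional R (discont_search R).
Proof.
move=> F f Ff bv lN; exists (search_approx F).
have DF : @codes_bv R F by exists f.
rewrite /discont_search asboolT//.
have [[y dy ny]|nX] :=
  pselect (exists2 y, discont f y & forall z, ~ prec f z y); last first.
  (* Without a minimal point there is no jump, so all counts vanish, the output is 0 and [f] is
     absolutely continuous. *)
  exists 0; split=> //; last 2 first.
  - by rewrite lexx ler01.
  - move=> /(not_AC_discont bv lN)[x dx]; exfalso; apply: nX.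
    exact: prec_minimal dx.
  suff -> : search_approx F = fun n => CodeSeq.code [:: 0; 0; (2 ^ n.+2).-1]%N.
    apply: codes_real_approx => n.
    by rewrite rat_of_code3 subrr mul0r rmorph0 subrr normr0.
  apply/funext => n; congr (CodeSeq.code [:: _; _; _]); apply: big1 => j _.
  case: asboolP => // -[al [dal [nal _]]]; exfalso; apply: nX.
  have [x cx dx] := code_discont_real Ff dal; exists x => // z zx.
  by apply: nal; apply/(code_predP Ff cx dx); exists z.
have y01 := discont_01 dy.
exists y; split=> // [|_]; last exact: discont_discontinuous.
apply: codes_real_approx => n; rewrite rat_of_code3.
set N := (2 ^ n.+2)%N; have N0 : (0 < N)%N by rewrite expn_gt0.
have -> : (2 ^- n.+2 = N%:R^-1 :> R) by rewrite natrX.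
rewrite prednK// subr0.
have N0' : 0 < N%:R :> R by rewrite ltr0n.
have yN0 : 0 <= y * N%:R by case/andP: y01 => y0 _; rewrite mulr_ge0.
have /andP[ty yt] := truncn_itv yN0.
rewrite (_ : \sum_(j < N) _ = Num.truncn (y * N%:R))%N; last first.
  (* The positive integers up to [y * N] are at most [N] because [y <= 1], so the count misses
     none. *)
  transitivity (\sum_(j < N) (j.+1%:R <= y * N%:R :> R)%R)%N; last first.
    under eq_bigr do rewrite -truncn_ge_nat//.
    rewrite sum_ltn; apply/minn_idPr; rewrite -(ler_nat R) (le_trans ty)//.
    by rewrite ler_piMl// (andP y01).2.
  apply: eq_bigr => j _; congr nat_of_bool.
  have jE x al : codes_real al x ->
      code_below al (CodeSeq.code [:: j.+1; 0; N.-1]%N) <-> ~ (j.+1%:R <= x * N%:R).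
    move=> cx; rewrite (code_belowP cx) rat_of_code3 prednK// subr0.
    rewrite fmorph_div/= !ratr_nat ltr_pdivlMr// real_leNgt ?num_real//.
    by split=> [->//|/negP]; rewrite negbK.
  apply/asboolP/idP => [[al [dal [nal bal]]]|jy].
    have [x cx dx] := code_discont_real Ff dal.
    move: bal; rewrite (jE _ _ cx) => /contrapT; suff -> : x = y by [].
    apply/eqP/negPn/negP => /(prec_total f)[/ny//|yx].
    by apply: nal; apply/(code_predP Ff cx dx); exists y.
  have [al cy] := exists_code y; exists al; split; first exact/(code_discontP Ff cy).
  split; first by move/(code_predP Ff cy dy) => [z /ny].
  by rewrite (jE _ _ cy).
rewrite fmorph_div/= !ratr_nat -[X in _ - X](@mulfK _ N%:R) ?gt_eqF//.
rewrite -mulrBl normrM [X in _ * X]gtr0_norm ?invr_gt0// ler_piMl ?invr_ge0//.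
by rewrite ler_norml; apply/andP; split; move: yt; rewrite -natr1; lra.
Qed.
End Search.

(** * Omega from a discontinuity functional *)

Section Indicator.
Context {R : realType}.
Implicit Types (X : set R) (a x : R).

Lemma indic_subset1 X : is_subset1 X -> X = set0 \/ exists a, X = [set a].
Proof.
move=> X1; have [->|/set0P[a Xa]] := eqVneq X set0; first by left.
by right; exists a; apply/seteqP; split=> [x Xx|_ ->//]; exact: X1.
Qed.

Lemma bounded_variation_indic1 a : bounded_variation 0 1 (\1_[set a] : R -> R).
Proof.
have -> : \1_[set a] =
    (fun x : R => (a <= x)%R%:R) \+ (\- (fun x : R => (a < x)%R%:R)) :> (R -> R).
  apply/funext => x; rewrite indicE /=; case: (ltgtP a x) => ax.
  - by rewrite memNset ?subrr// => E; rewrite E ltxx in ax.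
  - by rewrite memNset ?subrr// => E; rewrite E ltxx in ax.
  - by rewrite mem_set// subr0.
apply: bounded_variationD => //; [|apply: bounded_variationN].
  apply: nondecreasing_bounded_variation => x y _ _ xy; rewrite ler_nat.
  by case: (leP a x) => // ax; rewrite (le_trans ax).
apply: nondecreasing_bounded_variation => x y _ _ xy; rewrite ler_nat.
by case: (ltP a x) => // ax; rewrite (lt_le_trans ax).
Qed.

Lemma bounded_variation_indic X : is_subset1 X ->
  bounded_variation 0 1 (\1_X : R -> R).
Proof.
move=> /indic_subset1[->|[a ->]]; last exact: bounded_variation_indic1.
by apply: nondecreasing_bounded_variation => x y _ _ xy; rewrite !indicE !in_set0.
Qed.

Lemma lusinN_indic X : lusinN (\1_X : R -> R).
Proof.
move=> N _ _.
suff : (@lebesgue_measure R).-negligible [set 0; 1].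
  by apply: negligibleS => _ [x _ <-]; rewrite indicE; case: (x \in X); [right|left].
by apply: negligibleU; apply/negligibleP => //; exact: lebesgue_measure_set1.
Qed.

Lemma not_AC_indic1 a : 0 <= a <= 1 -> ~ Defs.AC (\1_[set a] : R -> R).
Proof.
move=> /andP[a0 a1] /(_ 0%N)[N].
have p0 : 0 < 2 ^- N :> R by rewrite invr_gt0 exprn_gt0.
move=> AC.
have {}AC (x y : R) : 0 <= x -> x < y -> y <= 1 -> y - x < 2 ^- N ->
    `|\1_[set a] y - \1_[set a] x : R| < 1.
  move=> x0 xy y1 l; have := AC 1%N (fun=> x) (fun=> y).
  rewrite !big_ord1 expr0 invr1; apply=> //.
  by move=> i j _ _ _; rewrite !ord1.
have one : \1_[set a] a = 1 :> R by rewrite indicE mem_set.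
have zero x : x != a -> \1_[set a] x = 0 :> R.
  by move=> xa; rewrite indicE memNset// => E; rewrite E eqxx in xa.
(* An interval of length at most [2 ^- N / 2] ends at [a]; it goes to the right, or to the left if
   [a = 1], to stay in the unit interval. *)
have [a_lt|a_ge] := ltP a 1.
  pose y := Num.min 1 (a + 2 ^- N / 2).
  have ay : a < y by rewrite lt_min a_lt/=; lra.
  have := AC a y a0 ay; rewrite one zero ?gt_eqF// sub0r normrN1 ltxx.
  have /andP[y1 y2] : (y <= 1) && (y <= a + 2 ^- N / 2) by rewrite -le_min.
  by move=> H'; suff: false by []; apply: H' => //; lra.
pose x := Num.max 0 (a - 2 ^- N / 2).
have xa : x < a by rewrite gt_max; apply/andP; split; lra.
have /andP[x1 x2] : (0 <= x) && (a - 2 ^- N / 2 <= x) by rewrite -ge_max.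
have := AC x a x1 xa a1; rewrite one zero ?lt_eqF// subr0 normr1 ltxx.
by move=> H'; suff: false by []; apply: H' => //; lra.
Qed.

Lemma discontinuous_indic1 a x :
  discontinuous_at (\1_[set a] : R -> R) x -> x = a.
Proof.
move=> dx; apply: contrapT => /eqP xa; apply: dx.
have xa0 : 0 < `|x - a| by rewrite normr_gt0 subr_eq0.
apply: cvg_near_cst; exists `|x - a| => // y /= xy _.
rewrite !indicE !memNset//; first by move=> E; rewrite E eqxx in xa.
by move=> E; rewrite E ltxx in xy.
Qed.
End Indicator.

Definition indic_code (F : functional (baire ~> Nat)) : functional (baire ~> baire) :=
  fun al _ => CodeSeq.code [:: F al; 0; 0]%N.

Lemma indic_codeP (R : realType) F (X : set R) :
  codes_set F X -> codes_fun (indic_code F) (\1_X : R -> R).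
Proof.
move=> [_ FX] x al x01 cx; rewrite /indic_code (FX x al x01 cx).
have := @codes_real_rat R (CodeSeq.code [:: (x \in X) : nat; 0; 0]%N).
by rewrite rat_of_code3 subr0 divr1 ratr_nat indicE.
Qed.

(* The code of [:: 0; n] is 2 ^ n.+1 + 1. *)
Definition snd_code m := (\sum_(j < m) `[< 2 ^ j.+2 <= m >])%N.

Lemma snd_codeK n : snd_code (CodeSeq.code [:: 0; n])%N = n.
Proof.
have -> : CodeSeq.code [:: 0; n]%N = (2 ^ n.+1).+1.
  by rewrite /CodeSeq.code/= !mul1n muln1 -mul2n expnS.
rewrite /snd_code -[RHS](minn_idPr (_ : n <= (2 ^ n.+1).+1)%N); last first.
  by rewrite leqW// ltnW// (leq_trans (ltnSn n))// ltnW// ltn_expl.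
rewrite -sum_ltn; apply: eq_bigr => j _; congr nat_of_bool; rewrite asboolb.
(* Equality of [2 ^ j.+2] with [2 ^ n.+1 + 1] is excluded by parity, so exactly the [j < n] are
   counted. *)
rewrite leq_eqVlt ltnS leq_exp2l// ltnS orbC; case: ltnP => //= nj.
by apply/negbTE/negP => /eqP/(congr1 odd); rewrite !oddS !oddX.
Qed.

(** The sequence returned has length 1, so its only index is 0 and [snd_code] recovers the
    precision. The test cuts the domain down to that of Omega; it never has to be computed, as
    computability concerns defined values only. *)
Definition Omega_of (R : realType) (Phi : pfunctional ((baire ~> baire) ~> baire)) :
    pfunctional ((baire ~> Nat) ~> baire) := fun F n =>
  if `[< exists2 X : set R, codes_set F X & is_subset1 X >] then
    if n is m.+1 then Phi (indic_code F) (snd_code m) else Some 1%N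
  else None.

Section Omega_of.
Context {R : realType}.
Variable Phi : pfunctional ((baire ~> baire) ~> baire).
Hypothesis PhiP : @discontinuity_functional R Phi.

Lemma Omega_ofP : is_Omega R (Omega_of R Phi).
Proof.
move=> F; split=> [X FX X1|nX n]; last by rewrite /Omega_of asboolF.
have [be [x [Hbe cx x01 Hx]]] := PhiP (indic_codeP FX)
  (bounded_variation_indic X1) (@lusinN_indic R X).
exists (fun n => if n is m.+1 then be (snd_code m) else 1%N), [:: x]; split.
- move=> n; rewrite /Omega_of asboolT; last by exists X.
  by case: n => // m; rewrite Hbe.
- split=> // -[|//] _ /=; congr (codes_real _ _): cx.
  by apply/funext => n; rewrite snd_codeK.
- move=> y Xy; rewrite inE; apply/eqP.
  have XE : X = [set y] by apply/seteqP; split=> [z Xz|_ ->//]; exact: X1.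
  have y01 : 0 <= y <= 1 by have := FX.1 y Xy; rewrite /= in_itv.
  by rewrite XE in Hx; exact/esym/discontinuous_indic1/Hx/not_AC_indic1.
Qed.

Definition class_env : env (functional (baire ~> Nat) * functional Nat).
Proof.
by exists (fun p => [:: tent p.1; nent p.2; pent Phi; tent existsE2]) 4%N 3%N.
Defined.

Lemma Omega_computable : Omega_computable_in R Phi.
Proof.
exists (Omega_of R Phi); first exact: Omega_ofP.
pose D (p : functional (baire ~> Nat) * functional Nat) :=
  exists2 X : set R, codes_set p.1 X & is_subset1 X.
pose g (p : functional (baire ~> Nat) * functional Nat) :=
  odflt 0%N (Phi (indic_code p.1) (snd_code p.2.-1)).
suff [e He] : Comp class_env D (fun p => if p.2 == 0%N then 1%N else g p).
  exists e => -[F [n []]] a; rewrite /= /Omega_of; case: asboolP => // DF E.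
  have := He (F, n) DF; rewrite /g/=; case: n E => [[<-]//|m] /=.
  by move=> ->.
apply: comp_if; first by apply: comp_eq0; cvar.
  exact: comp_const.
apply: (@comp_applyP _ Phi 2 _ _ (fun p => snd_code p.2.-1) _
    (fun p => indic_code p.1.1.1 p.2 p.1.2)) => //.
- apply: comp_code3; [|exact: comp_const..].
  apply: (comp_apply2 (F := fun p => p.1.1.1) (b := fun p => p.1.2 p.2)
    (i := 2%N)) => //.
  have vb : Fun (push (push class_env Nat) baire)
      (fun p => D p.1.1 /\ ~ (p.1.1.2 == 0%N)) (fun p => p.2).
    exact/fun_var/var_top.
  exact: vb.
- have cm : Comp class_env (fun p => D p /\ ~ (p.2 == 0%N)) (fun p => p.2.-1).
    by apply: comp_pred; cvar.
  apply: (comp_sum (b := fun p j => nat_of_bool `[< 2 ^ j.+2 <= p.2.-1 >]%N)) => //.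
  apply: dec_leq; last exact: (comp_wk Nat cm).
  by apply: comp_exp; [exact: comp_const|do 2 apply: comp_succ; cvar].
- move=> [F n] [[X FX X1] _]; rewrite /g/=.
  have [be [x [Hbe _ _ _]]] := PhiP (indic_codeP FX)
    (bounded_variation_indic X1) (@lusinN_indic R X).
  by rewrite -/(indic_code F) Hbe.
Qed.
End Omega_of.

Theorem theorem4p37 (R : realType) :
  class_in_Omega_cluster R (@discontinuity_functional R).
Proof.
split; first exact: Omega_computable.
exists (discont_search R); first exact: search_class.
split; first exact: search_computable.
exact/Omega_computable/search_class.
Qed.
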